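(* Let $\ell\ge 1$ and let $N$ be a positive integer. The spaces of holomorphic sections of the canonical line bundles $L_{N}$ and $L_{-N}$ over the quantum projective space $\mathbb{C}P^\ell_q$ are $$H^0(L_N,\nabla_N^{\overline\partial})\simeq \mathbb{C}^{\binom{N+\ell}{\ell}},\qquad H^0(L_{-N},\nabla_{-N}^{\overline\partial})=0 .$$
   Context: Throughout $0<q<1$, $\ell\ge 1$ is an integer, $[n]=\frac{q^n-q^{-n}}{q-q^{-1}}$, $[n]!=[n][n-1]\cdots[1]$. $U_q(\mathfrak{su}(\ell+1))$ is the Hopf $*$-algebra generated by $K_i,K_i^{-1},E_i,F_i$ ($1\le i\le\ell$) with $K_i^*=K_i$, $E_i^*=F_i$ and relations (together with their adjoints) $K_iK_j=K_jK_i$, $E_iK_i=q^{-1}K_iE_i$, $E_iK_j=q^{1/2}K_jE_i$ if $|i-j|=1$, $E_iK_j=K_jE_i$ if $|i-j|>1$, $E_iF_j-F_jE_i=\delta_{ij}\frac{K_i^2-K_i^{-2}}{q-q^{-1}}$, $E_iE_j=E_jE_i$ if $|i-j|>1$, $E_i^2E_j-(q+q^{-1})E_iE_jE_i+E_jE_i^2=0$ if $|i-j|=1$; $\Delta(K_i)=K_i\otimes K_i$, $\Delta(E_i)=E_i\otimes K_i+K_i^{-1}\otimes E_i$, $\Delta(F_i)=F_i\otimes K_i+K_i^{-1}\otimes F_i$, $\epsilon(K_i)=1$, $\epsilon(E_i)=0$, $S(K_i)=K_i^{-1}$, $S(E_i)=-qE_i$. $\mathcal A(SU_q(\ell+1))$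 is the Hopf $*$-algebra generated by $u^i_j$ ($1\le i,j\le\ell+1$) with $u^i_ku^j_k=qu^j_ku^i_k$ and $u^k_iu^k_j=qu^k_ju^k_i$ for $i<j$; $[u^i_l,u^j_k]=0$ and $[u^i_k,u^j_l]=(q-q^{-1})u^i_lu^j_k$ for $i<j$, $k<l$; quantum determinant $\sum_{\pi\in S_{\ell+1}}(-q)^{\|\pi\|}u^1_{\pi(1)}\cdots u^{\ell+1}_{\pi(\ell+1)}=1$ ($\|\pi\|$ the number of inversions); $\Delta(u^i_j)=\sum_k u^i_k\otimes u^k_j$, $\epsilon(u^i_j)=\delta^i_j$, $S(u^i_j)=(u^j_i)^*$. The Hopf pairing is determined by $\langle K_r,u^i_j\rangle=\delta^i_jq^{\frac12(\delta_{r+1,i}-\delta_{r,i})}$, $\langle E_r,u^i_j\rangle=\delta^i_{r+1}\delta^r_j$, $\langle F_r,u^i_j\rangle=\delta^i_{r}\delta^{r+1}_j$, and $a\triangleleft h=\sum\langle h,a_{(1)}\rangle a_{(2)}$ is the induced right action of $U_q(\mathfrak{su}(\ell+1))$ on $\mathcal A(SU_q(\ell+1))$. Put $z_j=u^{\ell+1}_j$. For $N\in\mathbb Z$, $L_N$ is the set of $a\in\mathcal A(SU_q(\ell+1))$ with $a\triangleleft K_i=a$, $a\triangleleft E_i=a\triangleleft F_i=0$ for $1\le i\le\ell-1$ and $a\triangleleft(K_1K_2^2\cdots K_\ell^\ell)=q^{N\ell/2}a$. $\mathcal A(\mathbb{C}P^\ell_q):=L_0$; each $L_N$ is an $\mathcal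 A(\mathbb{C}P^\ell_q)$-bimodule. $\Omega^{(0,1)}$ is the $\mathcal A(\mathbb{C}P^\ell_q)$-bimodule of $v=(v_1,\dots,v_\ell)\in\mathcal A(SU_q(\ell+1))^\ell$ such that for $1\le r\le\ell-1$: $v_I\triangleleft K_r=q^{\frac12(\delta_{I,r}-\delta_{I,r+1})}v_I$, $v_I\triangleleft E_r=\delta_{I,r}v_{r+1}$, $v_I\triangleleft F_r=\delta_{I,r+1}v_r$, and $v_I\triangleleft(K_1K_2^2\cdots K_\ell^\ell)=q^{(\ell+1)/2}v_I$. For $a\in\mathcal A(\mathbb{C}P^\ell_q)$, $\overline\partial a=-(a\triangleleft F_\ell F_{\ell-1}\cdots F_1,\ a\triangleleft F_\ell\cdots F_2,\ \dots,\ a\triangleleft F_\ell)\in\Omega^{(0,1)}$. Identify $\Omega^{(0,1)}\otimes_{\mathcal A(\mathbb{C}P^\ell_q)}L_N$ with a subspace of $\mathcal A(SU_q(\ell+1))^\ell$ by $v\otimes\xi\mapsto(v_1\xi,\dots,v_\ell\xi)$. For $N\ge0$ the holomorphic connection $\nabla_N^{\overline\partial}:L_N\to\Omega^{(0,1)}\otimes_{\mathcal A(\mathbb{C}P^\ell_q)}L_N$ is $\nabla_N^{\overline\partial}(\xi)=q^{-N}\Psi_N^\dagger\,\overline\partial(\Psi_N\xi)$, where $\Psi_N$ is the column vector with entries $\psi^N_{j_1,\dots,j_{\ell+1}}=[j_1,\dots,j_{\ell+1}]!^{1/2}(z_1^{j_1}\cdots z_{\ell+1}^{j_{\ell+1}})^*$,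 $j_1+\dots+j_{\ell+1}=N$, and $[j_1,\dots,j_k]!=q^{-\sum_{r<s}j_rj_s}\frac{[j_1+\cdots+j_k]!}{[j_1]!\cdots[j_k]!}$. Explicitly, $\nabla_N^{\overline\partial}\xi=-q^{-N/2}(\xi\triangleleft F_\ell\cdots F_1,\dots,\xi\triangleleft F_\ell F_{\ell-1},\ \xi\triangleleft F_\ell)$, and for $N<0$ the connection $\nabla_N^{\overline\partial}$ is given by this last formula. $H^0(L_N,\nabla_N^{\overline\partial}):=\ker\nabla_N^{\overline\partial}$. *)

(* Defs.v *)
From HB Require Import structures.
From mathcomp Require Import all_boot all_order all_algebra all_fingroup.
From mathcomp Require Import sesquilinear complex.
From mathcomp Require Import boolp classical_sets reals.

Set Implicit Arguments.
Unset Strict Implicit.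
Unset Printing Implicit Defensive.
Import Order.TTheory GRing.Theory Num.Theory.
Local Open Scope ring_scope.
Local Open Scope complex_scope.
Local Open Scope classical_set_scope.

(* A list of pairs [:: (x1, y1); ...; (xn, yn)] stands for the tensor
   x1 (x) y1 + ... + xn (x) yn.  By the universal property of the tensor
   product, two such sums are the same tensor if and only if every bilinear
   map takes the same value on both; likewise for triples. *)
Definition tensor2_eq (C : nzRingType) (U V : lmodType C)
    (s t : seq (U * V)) : Prop :=
  forall (W : lmodType C) (b : {bilinear U -> V -> W}),
    \sum_(p <- s) b p.1 p.2 = \sum_(p <- t) b p.1 p.2.

Definition trilinear (C : nzRingType) (U V W X : lmodType C)
    (f : U -> V -> W -> X) : Prop :=
  [/\ forall v w, linear (fun u => f u v w),
      forall u w, linear (fun v => f u v w) &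
      forall u v, linear (f u v)].

Definition tensor3_eq (C : nzRingType) (U V W : lmodType C)
    (s t : seq (U * V * W)) : Prop :=
  forall (X : lmodType C) (f : U -> V -> W -> X), trilinear f ->
    \sum_(p <- s) f p.1.1 p.1.2 p.2 = \sum_(p <- t) f p.1.1 p.1.2 p.2.

(* [comul x] is some representative of the tensor Delta(x), so every axiom
   (and every later use) only sees it up to [tensor2_eq] or through a bilinear
   expression. *)
HB.mixin Record Algebra_isHopfStar (C : numClosedFieldType) H
    of GRing.Algebra C H := {
  comul : H -> seq (H * H);
  counit : H -> C;
  antipode : H -> H;
  star : H -> H;
  comul_linear : forall (c : C) (x y : H),
    tensor2_eq (comul (c *: x + y))
               ([seq (c *: p.1, p.2) | p <- comul x] ++ comul y);
  comul1 : tensor2_eq (comul 1) [:: (1, 1)];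
  comulM : forall x y : H,
    tensor2_eq (comul (x * y))
               [seq (p.1 * r.1, p.2 * r.2) | p <- comul x, r <- comul y];
  comulA : forall x : H,
    tensor3_eq [seq (r.1, r.2, p.2) | p <- comul x, r <- comul p.1]
               [seq (p.1, r.1, r.2) | p <- comul x, r <- comul p.2];
  counit_linear : scalar counit;
  counit_monoid_morphism : monoid_morphism counit;
  counit_comull : forall x : H, \sum_(p <- comul x) counit p.1 *: p.2 = x;
  counit_comulr : forall x : H, \sum_(p <- comul x) counit p.2 *: p.1 = x;
  antipode_linear : linear antipode;
  antipodel : forall x : H,
    \sum_(p <- comul x) antipode p.1 * p.2 = (counit x)%:A;
  antipoder : forall x : H,
    \sum_(p <- comul x) p.1 * antipode p.2 = (counit x)%:A;
  starK : involutive star;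
  star_antilinear : forall (c : C) (x y : H),
    star (c *: x + y) = (c^*)%R *: star x + star y;
  starM : forall x y : H, star (x * y) = star y * star x;
  comul_star : forall x : H,
    tensor2_eq (comul (star x)) [seq (star p.1, star p.2) | p <- comul x]
}.

#[short(type="hopfStarAlgType")]
HB.structure Definition HopfStarAlgebra (C : numClosedFieldType) :=
  {H of Algebra_isHopfStar C H & GRing.Algebra C H}.

Record hopf_pairing (C : numClosedFieldType) (U A : hopfStarAlgType C)
    (P : {bilinear U -> A -> C | *%R & *%R}) : Prop := HopfPairing {
  pairing_mull : forall g h a,
    P (g * h) a = \sum_(p <- comul a) P g p.1 * P h p.2;
  pairing_mulr : forall h a b,
    P h (a * b) = \sum_(p <- comul h) P p.1 a * P p.2 b;
  pairing1l : forall a, P 1 a = counit a;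
  pairing1r : forall h, P h 1 = counit h;
  pairing_antipode : forall h a, P (antipode h) a = P h (antipode a)
}.

(* a <| h = <h, a_(1)> a_(2) *)
Definition ract (C : numClosedFieldType) (U A : hopfStarAlgType C)
    (P : U -> A -> C) (a : A) (h : U) : A :=
  \sum_(p <- comul a) P h p.1 *: p.2.

(* Indices are shifted by one: the index i of the literature, running from 1,
   is the ordinal of value i - 1.  In particular K_i, E_i, F_i are indexed by
   'I_l and u^i_j by i, j : 'I_l.+1, and u i j is u^i_j (upper index first). *)

Section QuantumGroups.
Variables (R : realType) (q : R) (l : nat).
Local Notation C := R[i].

(* Algebra relations of U_q(su(l+1)), together with their images under the
   involution K_i^* = K_i, E_i^* = F_i.  K' i is the inverse of K i. *)
Record Uq_relations (B : algType C) (K K' E F : 'I_l -> B) : Prop :=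
    UqRelations {
  Uq_KV : forall i, K i * K' i = 1 /\ K' i * K i = 1;
  Uq_KK : forall i j, K i * K j = K j * K i;
  Uq_EK : forall i, E i * K i = (q^-1)%:C *: (K i * E i);
  Uq_KF : forall i, K i * F i = (q^-1)%:C *: (F i * K i);
  Uq_EKadj : forall i j : 'I_l, (i.+1 == j) || (j.+1 == i) ->
    E i * K j = (Num.sqrt q)%:C *: (K j * E i);
  Uq_KFadj : forall i j : 'I_l, (i.+1 == j) || (j.+1 == i) ->
    K j * F i = (Num.sqrt q)%:C *: (F i * K j);
  Uq_EKfar : forall i j : 'I_l, (i.+1 < j)%N || (j.+1 < i)%N ->
    E i * K j = K j * E i;
  Uq_KFfar : forall i j : 'I_l, (i.+1 < j)%N || (j.+1 < i)%N ->
    K j * F i = F i * K j;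
  Uq_EF : forall i j, E i * F j - F j * E i =
    if i == j then ((q - q^-1)^-1)%:C *: (K i ^+ 2 - K' i ^+ 2) else 0;
  Uq_EEfar : forall i j : 'I_l, (i.+1 < j)%N || (j.+1 < i)%N ->
    E i * E j = E j * E i;
  Uq_FFfar : forall i j : 'I_l, (i.+1 < j)%N || (j.+1 < i)%N ->
    F j * F i = F i * F j;
  Uq_serreE : forall i j : 'I_l, (i.+1 == j) || (j.+1 == i) ->
    E i ^+ 2 * E j - (q + q^-1)%:C *: (E i * E j * E i) + E j * E i ^+ 2 = 0;
  Uq_serreF : forall i j : 'I_l, (i.+1 == j) || (j.+1 == i) ->
    F j * F i ^+ 2 - (q + q^-1)%:C *: (F i * F j * F i) + F i ^+ 2 * F j = 0
}.

Record is_Uq_su (U : hopfStarAlgType C) (K K' E F : 'I_l -> U) : Prop :=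
    IsUqSu {
  Uq_rel : Uq_relations K K' E F;
  Uq_universal : forall (B : algType C) (k k' e f : 'I_l -> B),
    Uq_relations k k' e f ->
    exists phi : {lrmorphism U -> B},
      (forall i, [/\ phi (K i) = k i, phi (K' i) = k' i,
                     phi (E i) = e i & phi (F i) = f i]) /\
      (forall psi : {lrmorphism U -> B},
        (forall i, [/\ psi (K i) = k i, psi (K' i) = k' i,
                       psi (E i) = e i & psi (F i) = f i]) -> psi =1 phi);
  Uq_starK : forall i, star (K i) = K i;
  Uq_starE : forall i, star (E i) = F i;
  Uq_comulK : forall i, tensor2_eq (comul (K i)) [:: (K i, K i)];
  Uq_comulE : forall i,
    tensor2_eq (comul (E i)) [:: (E i, K i); (K' i, E i)];
  Uq_comulF : forall i,
    tensor2_eq (comul (F i)) [:: (F i, K i); (K' i, F i)];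
  Uq_counitK : forall i, counit (K i) = 1;
  Uq_counitE : forall i, counit (E i) = 0;
  Uq_antipodeK : forall i, antipode (K i) = K' i;
  Uq_antipodeE : forall i, antipode (E i) = - q%:C *: E i
}.

Definition inversions (p : 'S_l.+1) : nat :=
  #|[set ij : 'I_l.+1 * 'I_l.+1 | (ij.1 < ij.2)%N && (p ij.2 < p ij.1)%N]%SET|.

Record SUq_relations (B : algType C) (u : 'I_l.+1 -> 'I_l.+1 -> B) : Prop :=
    SUqRelations {
  SUq_col : forall i j k : 'I_l.+1, (i < j)%N ->
    u i k * u j k = q%:C *: (u j k * u i k);
  SUq_row : forall i j k : 'I_l.+1, (i < j)%N ->
    u k i * u k j = q%:C *: (u k j * u k i);
  SUq_anti : forall i j k m : 'I_l.+1, (i < j)%N -> (k < m)%N ->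
    u i m * u j k - u j k * u i m = 0;
  SUq_diag : forall i j k m : 'I_l.+1, (i < j)%N -> (k < m)%N ->
    u i k * u j m - u j m * u i k = (q - q^-1)%:C *: (u i m * u j k);
  SUq_det : \sum_(p : 'S_l.+1)
    (- q%:C) ^+ inversions p *: \prod_(i < l.+1) u i (p i) = 1
}.

(* Since u^{i*}_j is the antipode of u^j_i, i.e. a signed quantum minor, the
   u^i_j alone generate the *-algebra A(SU_q(l+1)) as an algebra. *)
Record is_A_SUq (A : hopfStarAlgType C) (u : 'I_l.+1 -> 'I_l.+1 -> A) : Prop :=
    IsASUq {
  SUq_rel : SUq_relations u;
  SUq_universal : forall (B : algType C) (v : 'I_l.+1 -> 'I_l.+1 -> B),
    SUq_relations v ->
    exists phi : {lrmorphism A -> B},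
      (forall i j, phi (u i j) = v i j) /\
      (forall psi : {lrmorphism A -> B},
        (forall i j, psi (u i j) = v i j) -> psi =1 phi);
  SUq_comul : forall i j,
    tensor2_eq (comul (u i j)) [seq (u i k, u k j) | k <- enum 'I_l.+1];
  SUq_counit : forall i j, counit (u i j) = (i == j)%:R;
  SUq_antipode : forall i j, antipode (u i j) = star (u j i)
}.

(* q^{(delta_{r+1,i} - delta_{r,i})/2} is written as an integer power of
   sqrt q. *)
Record is_canonical_pairing (U A : hopfStarAlgType C) (K E F : 'I_l -> U)
    (u : 'I_l.+1 -> 'I_l.+1 -> A)
    (P : {bilinear U -> A -> C | *%R & *%R}) : Prop := IsCanonicalPairing {
  canonical_hopf_pairing : hopf_pairing P;
  pairingK : forall (r : 'I_l) (i j : 'I_l.+1), P (K r) (u i j) =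
    if i == j
    then (Num.sqrt q ^ ((r.+1 == i :> nat)%:Z - (r == i :> nat)%:Z))%:C else 0;
  pairingE : forall (r : 'I_l) (i j : 'I_l.+1), P (E r) (u i j) =
    ((i == r.+1 :> nat) && (j == r :> nat))%:R;
  pairingF : forall (r : 'I_l) (i j : 'I_l.+1), P (F r) (u i j) =
    ((i == r :> nat) && (j == r.+1 :> nat))%:R
}.

Section LineBundles.
Variables (U A : hopfStarAlgType C) (K E F : 'I_l -> U).
Variables (u : 'I_l.+1 -> 'I_l.+1 -> A).
Variable P : U -> A -> C.
Local Notation "a ◁ h" := (ract P a h) (at level 40, left associativity).

Definition lineBundle (N : int) : set A :=
  [set a | (forall i : 'I_l, (i.+1 < l)%N ->
              [/\ a ◁ K i = a, a ◁ E i = 0 & a ◁ F i = 0]) /\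
           a ◁ (\prod_(i < l) K i ^+ i.+1)
             = (Num.sqrt q ^ (N * l%:Z))%:C *: a].

(* F_l F_{l-1} ... F_i, from left to right *)
Definition Fdown (i : 'I_l) : U :=
  \prod_(k <- rev (enum 'I_l) | (i <= k)%N) F k.

Definition dbar (a : A) : 'rV[A]_l := \row_(i < l) - (a ◁ Fdown i).

Definition qnum (n : nat) : R := (q ^+ n - q ^- n) / (q - q^-1).

Definition qfact (n : nat) : R := \prod_(k < n) qnum k.+1.

Definition qmultinomial (J : 'I_l.+1 -> nat) : R :=
  q ^- (\sum_(r < l.+1) \sum_(s < l.+1 | (r < s)%N) J r * J s)%N
  * qfact (\sum_r J r)%N / \prod_r qfact (J r).

Definition z (j : 'I_l.+1) : A := u ord_max j.

(* The entry of the column vector Psi_N of multi-index J. *)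
Definition psi (J : 'I_l.+1 -> nat) : A :=
  (Num.sqrt (qmultinomial J))%:C *: star (\prod_(j < l.+1) z j ^+ J j).

(* Omega^(0,1) (x) L_N is identified with a subspace of A^l, so the connection
   takes its values in 'rV[A]_l.  For N >= 0 it is
   q^{-N} Psi_N^dagger dbar (Psi_N xi), the multi-indices of total degree N
   being the J : 'I_l.+1 -> 'I_N.+1 with sum N. *)
Definition nabla (N : int) (xi : A) : 'rV[A]_l :=
  match N with
  | Posz n =>
      \row_(i < l) ((q ^- n)%:C *:
        \sum_(J : {ffun 'I_l.+1 -> 'I_n.+1} | (\sum_j J j == n)%N)
          star (psi (val \o J)) * dbar (psi (val \o J) * xi) 0 i)
  | Negz _ =>
      \row_(i < l) ((Num.sqrt q ^ (- N))%:C *: - (xi ◁ Fdown i))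
  end.

Definition H0 (N : int) : set A :=
  [set xi | lineBundle N xi /\ nabla N xi = 0].

End LineBundles.
End QuantumGroups.

(* The complex subspace S of V is linearly isomorphic to C^m. *)
Definition subspace_iso (C : fieldType) (V : lmodType C) (S : set V) (m : nat)
    : Prop :=
  exists f : {linear 'rV[C]_m -> V}, injective f /\ range f = S.

(* Main.v *)
From HB Require Import structures.
Require Import Defs.
From mathcomp Require Import all_boot all_order all_algebra fingroup perm.
From mathcomp Require Import sesquilinear complex spectral.
From mathcomp Require Import boolp classical_sets reals.
From mathcomp Require Import zify ring.

(** Write a <| h for the right action of U on A, and V for the vector
    representation, with basis e_1, ..., e_(l+1).

    Up to a nonzero scalar in each component, the connection sends xi to the
    row of the xi <| F_l F_(l-1) ... F_i.  For N >= 0 this has to be extracted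
    from the definition through Psi_N: the q-multinomial weights count words by
    inversions ([wordsumE]), which turns the sum over multi-indices into one
    over words, where the unitarity of the last row of u applies one letter at
    a time ([sum_zw_zstar]).  Hence the holomorphic sections of L_N are lowest
    weight vectors: they are killed by every F_r and have N times the last
    fundamental weight as weight ([nabla_eq0], [H0_lowest]).

    The monomials of degree N in the coordinates z_j are such vectors.  They are
    independent: they are eigenvectors of the left action with distinct
    weights, and none vanishes because the E_r push each of them to a nonzero
    multiple of a power of z_(l+1), whose counit is 1 ([zw_neq0], [zw_free]).
    There are 'C(N + l, l) of them.

    It remains to see that there is nothing else, a fact of Peter-Weyl type.
    For a word J of columns, the monomials u^I_J define a morphism of U-modules
    from a tensor power of V to A ([ract_phi]).  The tensor powers of V are
    unitary, so a lowest weight vector of A lifts to lowest weight vectors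
    orthogonal to all relations between the monomials ([lift_low]).  The
    columns of J may be taken in increasing order ([colspan_perm]); by
    orthogonality the lift is then q-symmetric in each block of equal columns
    ([lift_qsym]), so that it lives in a product of l+1 symmetric powers
    S^(d_1)(V), ..., S^(d_(l+1))(V).  The lowest weight vectors of weight lam in
    such a product are controlled by the semistandard tableaux of shape lam and
    content d: the letters of one block form a horizontal strip
    ([block_step]).  The lifts of interest have lam = (k, ..., k, k + N),
    written in increasing order, for some k, and this shape has at most one
    tableau of content d, with exactly one when all d_j are at least k.  So each
    d contributes at most a line ([lowest_lead]), and the relation det = 1 shows
    that this line is spanned by the monomial in z with exponents d_j - k
    ([low_line]).  In the case of L_(-N) the weight lam is not dominant, and
    there is no lowest weight vector at all ([low_neg]). *)

Set Implicit Arguments.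
Unset Strict Implicit.
Unset Printing Implicit Defensive.
Import Order.TTheory GRing.Theory Num.Theory.
Local Open Scope ring_scope.
Local Open Scope complex_scope.
Local Open Scope classical_set_scope.

(** * Words up to permutation *)

(** The commutation relations below only exchange neighbours; this reduces a
    statement about rearranged words to that case. *)
Lemma perm_eq_ind (T : eqType) (Q : seq T -> seq T -> Prop) :
  (forall s, Q s s) -> (forall s t v, Q s t -> Q t v -> Q s v) ->
  (forall x s t, Q s t -> Q (x :: s) (x :: t)) ->
  (forall x y s, Q [:: x, y & s] [:: y, x & s]) ->
  forall s t, perm_eq s t -> Q s t.
Proof.
move=> Q0 Qt Qc Qs.
have mv x s1 s2 : Q (x :: s1 ++ s2) (s1 ++ x :: s2).
  elim: s1 => [|y s1 IH] /=; first exact: Q0.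
  apply: Qt (Qs _ _ _) _; exact: Qc.
elim=> [|x s IH] t; first by rewrite perm_sym => /perm_nilP ->.
move=> st.
have xt : x \in t by rewrite -(perm_mem st) mem_head.
case/splitPr: xt st => t1 t2 st.
apply: Qt (mv x t1 t2); apply: Qc; apply: IH.
by rewrite -(perm_cons x) (perm_trans st) // -cat1s perm_catCA.
Qed.

(** * Representatives orthogonal to all relations *)

Section OrthogonalLift.
Variables (C : numClosedFieldType) (V : lmodType C).

(** Among the matrices whose rows lie in the subspace, one of maximal rank
    spans it, since adjoining a further vector cannot raise the rank. *)
Lemma subspace_basis n (N : 'rV[C]_n -> Prop) :
  N 0 -> (forall a u v, N u -> N v -> N (a *: u + v)) ->
  exists B : 'M[C]_n, forall v, N v <-> (v <= B)%MS.
Proof.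
move=> N0 Nl.
pose Q (k : nat) := `[< exists B : 'M[C]_n, \rank B = k /\ forall i, N (row i B) >].
have Qex : exists k, Q k.
  exists 0%N; apply/asboolP; exists 0; split; first exact: mxrank0.
  by move=> i; rewrite row0.
have Qb k : Q k -> (k <= n)%N.
  by move=> /asboolP [B [<- _]]; exact: rank_leq_row.
have [k /asboolP [B [rB NB]] kmax] := ex_maxnP Qex Qb.
have sub v : (v <= B)%MS -> N v.
  move=> /submxP [D ->]; rewrite mulmx_sum_row.
  elim/big_ind: _ => // [u w Nu Nw|i _].
    by rewrite -[u]scale1r; apply: Nl.
  by rewrite -[X in N X]addr0; apply: Nl.
exists B => v; split; last exact: sub.
move=> Nv; pose W := <<(B + v)%MS>>%MS.
have NW i : N (row i W).
  have : (row i W <= B + v)%MS by rewrite (submx_trans (row_sub _ _)) // genmxE.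
  case/sub_addsmxP => -[D1 D2] /= ->.
  rewrite -[_ *m B]scale1r; apply: (Nl _); first by apply: sub; rewrite submxMl.
  rewrite (mx11_scalar D2) mul_scalar_mx -[X in N X]addr0; exact: (Nl _).
have : (\rank W <= k)%N.
  by apply: kmax; apply/asboolP; exists W.
rewrite -rB genmxE => rk.
have := mxrank_leqif_sup (addsmxSl B v).
move=> [] _ /esym; rewrite eqn_leq rk mxrankS ?addsmxSl // => sBv.
by rewrite (submx_trans (addsmxSr B v)).
Qed.

(** Subtract from the coefficients their projection to the space of linear
    relations between the vectors g w. *)
Lemma ortho_lift_fin (W : finType) (g : W -> V) (c : W -> C) :
  exists c' : W -> C, \sum_w c' w *: g w = \sum_w c w *: g w /\
   forall v : W -> C, \sum_w v w *: g w = 0 -> \sum_w c' w * (v w)^* = 0.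
Proof.
pose Phi (x : 'rV[C]_#|W|) := \sum_w x 0 (enum_rank w) *: g w.
have PhiD a x y : Phi (a *: x + y) = a *: Phi x + Phi y.
  rewrite /Phi scaler_sumr -big_split /=; apply: eq_bigr => w _.
  by rewrite !mxE scalerDl scalerA.
have Phi0 : Phi 0 = 0.
  by rewrite /Phi big1 // => w _; rewrite mxE scale0r.
have [|a x y|B HB] := @subspace_basis #|W| (fun x => Phi x = 0) => //.
  by move=> hx hy; rewrite PhiD hx hy scaler0 addr0.
pose x : 'rV[C]_#|W| := \row_i c (enum_val i).
pose y := x *m proj_ortho B.
exists (fun w => (x - y) 0 (enum_rank w)); split.
  transitivity (Phi (x - y)) => //.
  rewrite -[x - y]addrC -scaleN1r PhiD.
  have -> : Phi y = 0 by apply/HB; exact: proj_ortho_sub.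
  rewrite scaler0 add0r; apply: eq_bigr => w _.
  by rewrite mxE enum_rankK.
move=> v hv; pose z : 'rV[C]_#|W| := \row_i v (enum_val i).
have zB : (z <= B)%MS.
  by apply/HB; rewrite -hv; apply: eq_bigr => w _; rewrite mxE enum_rankK.
have := proj_ortho_compl_sub B x; rewrite -/y => /orthomx1P xyB.
have /matrixP /(_ 0 0) : (x - y) *m (z^t*)%sesqui = 0.
  case/submxP: zB => D ->; rewrite trmx_mul map_mxM mulmxA.
  by rewrite xyB mul0mx.
rewrite mxE [RHS]mxE => xz; rewrite -[RHS]xz; rewrite (reindex (fun i : 'I_#|W| => enum_val i)) /=; last first.
  by apply: onW_bij; exact: enum_val_bij.
by apply: eq_bigr => i _; rewrite enum_valK !mxE.
Qed.

Lemma ortho_lift (T : eqType) (s : seq T) (g : T -> V) (c : T -> C) :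
  uniq s ->
  exists c' : T -> C, \sum_(w <- s) c' w *: g w = \sum_(w <- s) c w *: g w /\
   forall v : T -> C, \sum_(w <- s) v w *: g w = 0 ->
     \sum_(w <- s) c' w * (v w)^* = 0.
Proof.
case: s => [|x0 s'] us.
  by exists c; split => // v _; rewrite big_nil.
set s := x0 :: s' in us *.
have [c' [h1 h2]] :=
  @ortho_lift_fin 'I_(size s) (fun i => g (nth x0 s i)) (fun i => c (nth x0 s i)).
exists (fun w => c' (inord (index w s))).
have E (i : 'I_(size s)) : c' (inord (index (nth x0 s i) s)) = c' i.
  by rewrite index_uniq // inord_val.
split.
  rewrite !(big_nth x0) !big_mkord -h1; apply: eq_bigr => i _.
  by rewrite E.
move=> v; rewrite !(big_nth x0) !big_mkord => hv.
by rewrite -[RHS](h2 _ hv); apply: eq_bigr => i _; rewrite E.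
Qed.

End OrthogonalLift.

(** * Subalgebras cut out by a predicate *)

Section Subalgebra.
Variables (C : comNzRingType) (A : algType C) (S : A -> Prop).
Hypothesis S1 : S 1.
Hypothesis Slin : forall c a b, S a -> S b -> S (c *: a + b).
Hypothesis SM : forall a b, S a -> S b -> S (a * b).

Definition subalg_pred : {pred A} := fun a => `[< S a >].

Fact subalg_pred_closed : GRing.subalg_closed subalg_pred.
Proof.
split; first exact/asboolP.
  by move=> c a b /asboolP ha /asboolP hb; apply/asboolP; apply: Slin.
by move=> a b /asboolP ha /asboolP hb; apply/asboolP; apply: SM.
Qed.

HB.instance Definition _ :=
  GRing.isSubalgClosed.Build C A subalg_pred subalg_pred_closed.

Record subalg : predArgType :=
  Subalg { subalg_val : A; _ : subalg_val \in subalg_pred }.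
HB.instance Definition _ := [isSub for subalg_val].
HB.instance Definition _ := [Choice of subalg by <:].
HB.instance Definition _ := [SubChoice_isSubAlgebra of subalg by <:].

Definition subalg_inj (x : subalg) : A := \val x.
HB.instance Definition _ :=
  GRing.RMorphism.copy subalg_inj (\val : subalg -> A).
HB.instance Definition _ :=
  GRing.isScalable.Build C subalg A *:%R subalg_inj
    (fun c x => linearZ_LR ((\val : subalg -> A) : {linear subalg -> A}) c x).

(** Gives a subalgebra defined by a predicate a type of its own, so that a
    universal property can be applied to it. *)
Lemma subalg_incl : exists (B : algType C) (f : {lrmorphism B -> A}),
  injective f /\ forall a, S a <-> exists b, f b = a.
Proof.
exists subalg, subalg_inj; split; first exact: val_inj.
move=> a; split=> [ha|[[b hb] <-]]; last exact/asboolP.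
have h : a \in subalg_pred by apply/asboolP.
by exists (Subalg h).
Qed.

End Subalgebra.

(** * The left and right actions attached to a pairing *)

Section HopfActions.
Variables (C : numClosedFieldType).

Definition is_bilin (X Y Z : lmodType C) (b : X -> Y -> Z) : Prop :=
  (forall y, linear (b^~ y)) /\ (forall x, linear (b x)).

Lemma tensor2_bilin (X Y Z : lmodType C) (b : X -> Y -> Z)
    (s t : seq (X * Y)) :
  is_bilin b -> tensor2_eq s t ->
  \sum_(p <- s) b p.1 p.2 = \sum_(p <- t) b p.1 p.2.
Proof.
move=> [bl br] st.
pose bb := bilinear_isBilinear.Build C X Y Z _ _ b (bl, br).
pose B : {bilinear X -> Y -> Z} := HB.pack b bb.
exact: (st _ B).
Qed.

Variables (U A : hopfStarAlgType C) (P : {bilinear U -> A -> C | *%R & *%R}).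
Hypothesis hP : hopf_pairing P.

Lemma pairing_linr h c a b : P h (c *: a + b) = c * P h a + P h b.
Proof. by rewrite linearPr. Qed.

Lemma pairing_linl c h g a : P (c *: h + g) a = c * P h a + P g a.
Proof. by rewrite linearPl. Qed.

Lemma is_bilin_act h : is_bilin (fun x y : A => P h x *: y).
Proof.
split=> [y c x x'|x c y y'] /=.
  by rewrite pairing_linr scalerDl scalerA.
by rewrite scalerDr !scalerA mulrC.
Qed.

Lemma is_bilin_lact h : is_bilin (fun x y : A => P h y *: x).
Proof.
split=> [y c x x'|x c y y'] /=.
  by rewrite scalerDr !scalerA mulrC.
by rewrite pairing_linr scalerDl scalerA.
Qed.

Lemma is_bilin_pair h g : is_bilin (fun x y : A => P h x * P g y : C^o).
Proof.
split=> [y c x x'|x c y y'] /=.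
  by rewrite pairing_linr mulrDl -mulrA.
by rewrite pairing_linr mulrDr mulrCA.
Qed.

Lemma is_bilin_pairl a b : is_bilin (fun x y : U => P x a * P y b : C^o).
Proof.
split=> [y c x x'|x c y y'] /=.
  by rewrite pairing_linl mulrDl -mulrA.
by rewrite pairing_linl mulrDr mulrCA.
Qed.

Lemma comulM_bilin (H : hopfStarAlgType C) (Z : lmodType C)
    (b : H -> H -> Z) (x y : H) :
  is_bilin b -> \sum_(p <- comul (x * y)) b p.1 p.2 =
  \sum_(p <- comul x) \sum_(r <- comul y) b (p.1 * r.1) (p.2 * r.2).
Proof.
move=> hb; rewrite (tensor2_bilin hb (comulM x y)).
by rewrite big_allpairs_dep.
Qed.

Lemma comul_sub_bilin (H : hopfStarAlgType C) (Z : lmodType C)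
    (b : H -> H -> Z) (x y : H) (s t : seq (H * H)) :
  is_bilin b -> tensor2_eq (comul x) s -> tensor2_eq (comul y) t ->
  \sum_(p <- comul (x * y)) b p.1 p.2 =
  \sum_(p <- s) \sum_(r <- t) b (p.1 * r.1) (p.2 * r.2).
Proof.
move=> hb xs yt; rewrite comulM_bilin //.
rewrite (tensor2_bilin
  (b := fun v w => \sum_(r <- comul y) b (v * r.1) (w * r.2)) _ xs).
  apply: eq_bigr => p _.
  rewrite (tensor2_bilin (b := fun v w => b (p.1 * v) (p.2 * w)) _ yt) //.
  split=> [w c v v'|v c w w'] /=.
    by rewrite mulrDr -scalerAr hb.1.
  by rewrite mulrDr -scalerAr hb.2.
split=> [w c v v'|v c w w'] /=; rewrite scaler_sumr -big_split /=;
  apply: eq_bigr => r _.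
  by rewrite mulrDl -scalerAl hb.1.
by rewrite mulrDl -scalerAl hb.2.
Qed.

Lemma ract_lin h c a b : ract P (c *: a + b) h = c *: ract P a h + ract P b h.
Proof.
rewrite /Defs.ract (tensor2_bilin (is_bilin_act h) (comul_linear c a b)).
rewrite big_cat big_map scaler_sumr /=; congr (_ + _).
by apply: eq_bigr => p _; rewrite !scalerA linearZr.
Qed.

Lemma ract0 h : ract P 0 h = 0.
Proof.
have := ract_lin h (-1) 0 0.
by rewrite scaler0 addr0 scaleN1r addNr.
Qed.

Lemma ractZ h c a : ract P (c *: a) h = c *: ract P a h.
Proof. by rewrite -[c *: a]addr0 ract_lin ract0 addr0. Qed.

Lemma ractD h a b : ract P (a + b) h = ract P a h + ract P b h.
Proof. by have := ract_lin h 1 a b; rewrite !scale1r. Qed.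

Lemma ract_sum h (I : Type) (s : seq I) (Q : pred I) (f : I -> A) :
  ract P (\sum_(i <- s | Q i) f i) h = \sum_(i <- s | Q i) ract P (f i) h.
Proof.
by elim/big_rec2: _ => [|i x y _ <-]; [exact: ract0 | rewrite ractD].
Qed.

(** Coassociativity. *)
Lemma ractM a h g : ract P a (h * g) = ract P (ract P a h) g.
Proof.
rewrite {1 3}/Defs.ract ract_sum.
pose f (x y z : A) : A := (P h x * P g y) *: z.
have tf : trilinear f.
  split=> [v w c x x'|v w c x x'|v w c x x']; rewrite /f.
  - by rewrite pairing_linr mulrDl scalerDl scalerA mulrA.
  - by rewrite pairing_linr mulrDr scalerDl scalerA mulrCA.
  - by rewrite scalerDr !scalerA mulrC.
have := @comulA _ _ a _ f tf; rewrite !big_allpairs_dep /= => E.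
transitivity (\sum_(p <- comul a) \sum_(r <- comul p.1) f r.1 r.2 p.2).
  apply: eq_bigr => p _; rewrite (pairing_mull hP) scaler_suml.
  by apply: eq_bigr.
rewrite E; apply: eq_bigr => p _; rewrite ractZ /Defs.ract scaler_sumr.
by apply: eq_bigr => r _; rewrite scalerA.
Qed.

(** The left action h |> a, which commutes with the right one. *)
Definition lact (h : U) (a : A) : A := \sum_(p <- comul a) P h p.2 *: p.1.

Lemma lact_lin h c a b : lact h (c *: a + b) = c *: lact h a + lact h b.
Proof.
rewrite /lact (tensor2_bilin (is_bilin_lact h) (comul_linear c a b)).
rewrite big_cat big_map scaler_sumr /=; congr (_ + _).
by apply: eq_bigr => p _; rewrite !scalerA mulrC.
Qed.

Lemma lact0 h : lact h 0 = 0.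
Proof.
have := lact_lin h (-1) 0 0.
by rewrite scaler0 addr0 scaleN1r addNr.
Qed.

(** Elements of U enter only through the pairing, so the shape of their
    coproduct is recorded as a rule for pairing them with a product. *)
Definition grouplike (k : U) := forall a b, P k (a * b) = P k a * P k b.

Definition skewprimitive (k' f k : U) :=
  forall a b, P f (a * b) = P f a * P k b + P k' a * P f b.

Lemma lact_grouplike k a b : grouplike k ->
  lact k (a * b) = lact k a * lact k b.
Proof.
move=> hk; rewrite /lact (comulM_bilin _ _ (is_bilin_lact k)) mulr_suml.
apply: eq_bigr => p _; rewrite mulr_sumr; apply: eq_bigr => r _.
by rewrite hk -scalerAl -scalerAr scalerA.
Qed.

Lemma lact_skew k' f k a b : skewprimitive k' f k ->
  lact f (a * b) = lact f a * lact k b + lact k' a * lact f b.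
Proof.
move=> hk; rewrite /lact (comulM_bilin _ _ (is_bilin_lact f)) !mulr_suml.
rewrite -big_split /=; apply: eq_bigr => p _; rewrite !mulr_sumr.
rewrite -big_split /=; apply: eq_bigr => r _.
by rewrite hk -!scalerAl -!scalerAr !scalerA scalerDl.
Qed.

Lemma grouplike_comul k : tensor2_eq (comul k) [:: (k, k)] -> grouplike k.
Proof.
move=> hk a b; rewrite (pairing_mulr hP).
by rewrite (tensor2_bilin (is_bilin_pairl a b) hk) big_seq1.
Qed.

Lemma skew_comul k' f k :
  tensor2_eq (comul f) [:: (f, k); (k', f)] -> skewprimitive k' f k.
Proof.
move=> hk a b; rewrite (pairing_mulr hP).
by rewrite (tensor2_bilin (is_bilin_pairl a b) hk) big_cons big_seq1.
Qed.

(** Multiply the identity Delta(k) Delta(k') = 1 (x) 1 by k' (x) k'. *)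
Lemma grouplike_inv k k' : tensor2_eq (comul k) [:: (k, k)] ->
  k * k' = 1 -> k' * k = 1 -> grouplike k'.
Proof.
move=> hk kk' k'k a b.
have hb : is_bilin (fun x y : U => P (k' * x) a * P (k' * y) b : C^o).
  split=> [y c x x'|x c y y'] /=.
    by rewrite mulrDr -scalerAr pairing_linl mulrDl -mulrA.
  by rewrite mulrDr -scalerAr pairing_linl mulrDr mulrCA.
have e1 : \sum_(p <- comul (k * k')) (P (k' * p.1) a * P (k' * p.2) b : C^o) =
          P k' a * P k' b.
  rewrite kk' (tensor2_bilin hb (@comul1 _ U)) big_seq1 /=.
  by rewrite !mulr1.
rewrite -e1 (pairing_mulr hP) (comulM_bilin _ _ hb).
rewrite (tensor2_bilin
  (b := fun v w => \sum_(r <- comul k')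
     (P (k' * (v * r.1)) a * P (k' * (w * r.2)) b : C^o)) _ hk) /=.
  rewrite big_seq1; apply: eq_bigr => p _ /=.
  by rewrite !mulrA k'k !mul1r.
split=> [w c v v'|v c w w'] /=; rewrite scaler_sumr -big_split /=;
  apply: eq_bigr => r _.
  by rewrite mulrDl -scalerAl hb.1.
by rewrite mulrDl -scalerAl hb.2.
Qed.

End HopfActions.

(** * Tensor powers of the vector representation *)

Section QuantumProjectiveSpace.
Variables (R : realType) (q : R) (hq0 : 0 < q) (hq1 : q < 1).
Variables (l : nat).
Local Notation C := R[i].
Variables (U : hopfStarAlgType C) (K K' E F : 'I_l -> U).
Hypothesis hU : is_Uq_su q K K' E F.
Variables (A : hopfStarAlgType C) (u : 'I_l.+1 -> 'I_l.+1 -> A).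
Hypothesis hA : is_A_SUq q u.
Variable P : {bilinear U -> A -> C | *%R & *%R}.
Hypothesis hP : is_canonical_pairing q K E F u P.

Local Notation letter := 'I_l.+1.
Local Notation word := (seq 'I_l.+1).
Local Notation t := ((Num.sqrt q)%:C : C).
Let hpair := canonical_hopf_pairing hP.
Let hrel := Uq_rel hU.

Lemma t_gt0 : 0 < t. Proof. by rewrite ltcR sqrtr_gt0. Qed.
Lemma t_neq0 : t != 0. Proof. by rewrite gt_eqF ?t_gt0. Qed.
Lemma tX_gt0 (n : int) : 0 < t ^ n. Proof. exact/exprz_gt0/t_gt0. Qed.
Lemma tX_neq0 (n : int) : t ^ n != 0. Proof. by rewrite gt_eqF ?tX_gt0. Qed.

Lemma tXD (m n : int) : t ^ (m + n) = t ^ m * t ^ n.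
Proof. by rewrite expfzDr // t_neq0. Qed.

Lemma t_sqr : t ^+ 2 = q%:C.
Proof. by rewrite -rmorphXn /= sqr_sqrtr // ltW. Qed.

Lemma conj_gt0 (c : C) : 0 < c -> c^*%R = c.
Proof. by move=> c0; apply/CrealP/gtr0_real. Qed.

(** The simple root r joins the letters lo r and hi r; the right action of F_r
    turns lo r into hi r, and E_r turns it back. *)
Definition lo (r : 'I_l) : letter := widen_ord (leqnSn l) r.
Definition hi (r : 'I_l) : letter := lift ord0 r.

Lemma lo_hi r : lo r != hi r.
Proof. by rewrite -val_eqE /= /bump /= add1n neq_ltn ltnSn. Qed.

(** K_r acts on the letter i by the power wt1 r i of the square root of q. *)
Definition wt1 (r : 'I_l) (i : letter) : int := (hi r == i)%:Z - (lo r == i)%:Z.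

Definition wt (r : 'I_l) (s : word) : int :=
  (count_mem (hi r) s)%:Z - (count_mem (lo r) s)%:Z.

Lemma wt_cons r i s : wt r (i :: s) = wt1 r i + wt r s.
Proof. rewrite /wt /wt1 /= ![_ == i]eq_sym !PoszD; ring. Qed.

Lemma grouplikeK r : grouplike P (K r).
Proof. apply: (grouplike_comul hpair); exact: Uq_comulK hU r. Qed.

Lemma grouplikeK' r : grouplike P (K' r).
Proof.
have [h1 h2] := Uq_KV hrel r.
by apply: (grouplike_inv hpair _ h1 h2); exact: Uq_comulK hU r.
Qed.

Lemma skewE r : skewprimitive P (K' r) (E r) (K r).
Proof. apply: (skew_comul hpair); exact: Uq_comulE hU r. Qed.

Lemma skewF r : skewprimitive P (K' r) (F r) (K r).
Proof. apply: (skew_comul hpair); exact: Uq_comulF hU r. Qed.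

Lemma PKu r i j : P (K r) (u i j) = (i == j)%:R * t ^ wt1 r i.
Proof.
rewrite (pairingK hP); case: eqP => [->|_]; last by rewrite mul0r.
by rewrite mul1r fmorphXz /wt1; congr (_ ^ (_%:Z - _%:Z)).
Qed.

Lemma comul_u_bilin (Z : lmodType C) (b : A -> A -> Z) i j : is_bilin b ->
  \sum_(p <- comul (u i j)) b p.1 p.2 = \sum_k b (u i k) (u k j).
Proof.
move=> hb; rewrite (tensor2_bilin hb (SUq_comul hA i j)).
by rewrite big_map big_enum.
Qed.

(** K r * K' r = 1, and K r is diagonal. *)
Lemma PK'u r i j : P (K' r) (u i j) = (i == j)%:R * t ^ (- wt1 r i).
Proof.
have [h1 _] := Uq_KV hrel r.
have := pairing_mull hpair (K r) (K' r) (u i j).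
rewrite h1 (pairing1l hpair) (SUq_counit hA).
rewrite (comul_u_bilin i j (is_bilin_pair P (K r) (K' r))) => H.
rewrite (bigD1 i) //= big1 in H; last first.
  by move=> k /negPf ki; rewrite PKu eq_sym ki !mul0r.
rewrite addr0 PKu eqxx mul1r in H.
by rewrite -invr_expz H mulrC mulrA mulVf ?tX_neq0 // mul1r.
Qed.

Lemma PEu r i j : P (E r) (u i j) = ((i == hi r) && (j == lo r))%:R.
Proof. by rewrite (pairingE hP) -!val_eqE /= /bump /=. Qed.

Lemma PFu r i j : P (F r) (u i j) = ((i == lo r) && (j == hi r))%:R.
Proof. by rewrite (pairingF hP) -!val_eqE /= /bump /=. Qed.

Fixpoint words (n : nat) : seq word :=
  if n is n'.+1 then [seq i :: s | i <- enum 'I_l.+1, s <- words n']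
  else [:: [::]].

Lemma mem_words n s : (s \in words n) = (size s == n).
Proof.
elim: n s => [|n IH] [|i s] //=.
  by apply/negP => /allpairsP [[j v]] /= [].
rewrite eqSS; apply/allpairsP/idP => [[[j v] /= [_ hv [_ ->]]]|hs].
  by rewrite -IH.
by exists (i, s); rewrite /= mem_enum IH.
Qed.

Lemma words_uniq n : uniq (words n).
Proof.
elim: n => //= n IH; apply: allpairs_uniq => //; first exact: enum_uniq.
by move=> [i s] [j v] _ _ /= [-> ->].
Qed.

Lemma sum_wordsS (V : nmodType) n (f : word -> V) :
  \sum_(s <- words n.+1) f s = \sum_i \sum_(s <- words n) f (i :: s).
Proof. by rewrite /= big_allpairs_dep big_enum. Qed.

Lemma sum_words0 (V : nmodType) (f : word -> V) :
  \sum_(s <- words 0) f s = f [::].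
Proof. by rewrite big_seq1. Qed.

Lemma eq_words (V : nmodType) n (f g : word -> V) :
  (forall s, size s = n -> f s = g s) ->
  \sum_(s <- words n) f s = \sum_(s <- words n) g s.
Proof.
move=> fg; apply: eq_big_seq => s; rewrite mem_words => /eqP; exact: fg.
Qed.

Lemma sum_words_delta (V : nmodType) n (f : word -> V) s : size s = n ->
  (forall v, size v = n -> v != s -> f v = 0) ->
  \sum_(v <- words n) f v = f s.
Proof.
move=> hs f0; rewrite (bigD1_seq s) ?words_uniq ?mem_words ?hs ?eqxx //=.
rewrite big_seq_cond big1 ?addr0 // => v /andP [].
by rewrite mem_words => /eqP; apply: f0.
Qed.

Fixpoint mon (s v : word) : A :=
  match s, v with i :: s', j :: v' => u i j * mon s' v' | _, _ => 1 end.

Lemma is_bilin_of (X Y Z : lmodType C) (b : {bilinear X -> Y -> Z}) : is_bilin b.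
Proof. by split=> [y c x x'|x c y y']; rewrite ?linearPl ?linearPr. Qed.

Lemma comul_mon s v : size s = size v ->
  tensor2_eq (comul (mon s v))
    [seq (mon s w, mon w v) | w <- words (size s)].
Proof.
elim: s v => [|i s IH] [|j v] //=; first by move=> _; exact: comul1.
move=> [sv] W b.
rewrite (comul_sub_bilin (is_bilin_of b) (SUq_comul hA i j) (IH v sv)).
rewrite [LHS]big_map [RHS]big_map.
rewrite [RHS](sum_wordsS (size s) (fun w => b (mon (i :: s) w) (mon w (j :: v)))).
rewrite big_enum /=; apply: eq_bigr => k _; rewrite big_map.
by apply: eq_bigr.
Qed.

Lemma comul_mon_bilin (Z : lmodType C) (b : A -> A -> Z) s v :
  size s = size v -> is_bilin b ->
  \sum_(p <- comul (mon s v)) b p.1 p.2 =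
  \sum_(w <- words (size s)) b (mon s w) (mon w v).
Proof.
by move=> sv hb; rewrite (tensor2_bilin hb (comul_mon sv)) big_map.
Qed.

Lemma P1mon s v : size s = size v -> P 1 (mon s v) = (s == v)%:R.
Proof.
rewrite (pairing1l hpair).
have [c1 cM] := @counit_monoid_morphism C A.
elim: s v => [|i s IH] [|j v] //= [sv].
by rewrite cM (SUq_counit hA) IH // eqseq_cons -natrM mulnb.
Qed.

Lemma PKmon r s v : size s = size v ->
  P (K r) (mon s v) = (s == v)%:R * t ^ wt r s.
Proof.
elim: s v => [|i s IH] [|j v] //=.
  rewrite (pairing1r hpair) (Uq_counitK hU) => _.
  by rewrite ?eqxx mul1r /wt /= subrr expr0z.
move=> [sv]; rewrite grouplikeK PKu IH // eqseq_cons wt_cons (tXD (wt1 r i)).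
by rewrite mulrACA -natrM mulnb.
Qed.

Lemma PK'mon r s v : size s = size v ->
  P (K' r) (mon s v) = (s == v)%:R * t ^ (- wt r s).
Proof.
elim: s v => [|i s IH] [|j v] //=.
  have [h1 _] := Uq_KV hrel r; have [c1 cM] := @counit_monoid_morphism C U.
  rewrite (pairing1r hpair) => _.
  have := cM (K r) (K' r); rewrite h1 c1 (Uq_counitK hU) mul1r => <-.
  by rewrite ?eqxx mul1r /wt /= subrr oppr0 expr0z.
move=> [sv]; rewrite grouplikeK' PK'u IH // eqseq_cons wt_cons (opprD (wt1 r i)).
by rewrite (tXD (- wt1 r i)) mulrACA -natrM mulnb.
Qed.

(** The counit kills F_r because K_r F_r = q^-1 F_r K_r, the counit of K_r is 1
    and q is not 1. *)
Lemma counitF r : counit (F r) = 0.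
Proof.
have [_ cM] := @counit_monoid_morphism C U.
have := congr1 counit (Uq_KF hrel r).
have cl := @counit_linear C U.
have cZ (c : C) (x : U) : counit (c *: x) = c * counit x.
  have := cl c x 0; rewrite addr0 => ->.
  by have := cl (-1) 0 0; rewrite scaler0 addr0 mulN1r addNr => ->; rewrite addr0.
rewrite cZ !cM (Uq_counitK hU) mul1r mulr1 => /eqP.
rewrite -subr_eq0 -{1}[counit (F r)]mul1r -mulrBl mulf_eq0 => /orP [|/eqP //].
rewrite subr_eq0 => /eqP /(congr1 (fun x => complex.Re x)) /= h.
by move: hq1; rewrite -invf_gt1 // -h ltxx.
Qed.

Lemma PF_cons r i s j v : size s = size v ->
  P (F r) (mon (i :: s) (j :: v)) =
  ((i == lo r) && (j == hi r))%:R * ((s == v)%:R * t ^ wt r s) +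
  ((i == j)%:R * t ^ (- wt1 r i)) * P (F r) (mon s v).
Proof. by move=> sv; rewrite /= skewF PFu PK'u PKmon. Qed.

Lemma PE_cons r i s j v : size s = size v ->
  P (E r) (mon (i :: s) (j :: v)) =
  ((i == hi r) && (j == lo r))%:R * ((s == v)%:R * t ^ wt r s) +
  ((i == j)%:R * t ^ (- wt1 r i)) * P (E r) (mon s v).
Proof. by move=> sv; rewrite /= skewE PEu PK'u PKmon. Qed.

Lemma PF_nil r : P (F r) (mon [::] [::]) = 0.
Proof. by rewrite /= (pairing1r hpair) counitF. Qed.

Lemma PE_nil r : P (E r) (mon [::] [::]) = 0.
Proof. by rewrite /= (pairing1r hpair) (Uq_counitE hU). Qed.

(** The tensor powers of V are unitary: E_r and F_r are transposes on V, and
    their coproducts have the same shape. *)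
Lemma PE_PF r s v : size s = size v ->
  P (E r) (mon v s) = P (F r) (mon s v) /\
  (P (F r) (mon s v))^*%R = P (F r) (mon s v).
Proof.
elim: s v => [|i s IH] [|j v] // => [_|[sv]].
  by rewrite PF_nil PE_nil rmorph0.
have [e1 e2] := IH v sv; rewrite PF_cons // PE_cons // e1; split.
  rewrite andbC [j == i]eq_sym [v == s]eq_sym.
  by case: (s =P v) => [->|_]; case: (i =P j) => [->|_]; rewrite ?mul0r ?mulr0.
rewrite rmorphD !rmorphM /= !conjC_nat e2.
by rewrite !(conj_gt0 (tX_gt0 _)).
Qed.

(** A function on the words of length n is a vector of the n-th tensor power of
    V; the matrix of h is read off from the pairing with the monomials. *)
Definition act (h : U) (f : word -> C) (v : word) : C :=
  \sum_(s <- words (size v)) f s * P h (mon s v).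

Definition eqw n (f g : word -> C) := forall s, size s = n -> f s = g s.

Lemma act_eqw n h f g : eqw n f g -> eqw n (act h f) (act h g).
Proof. by move=> fg s hs; apply: eq_words => v hv; rewrite fg // hv. Qed.

Lemma act_lin h c f g v :
  act h (fun s => c * f s + g s) v = c * act h f v + act h g v.
Proof.
rewrite /act mulr_sumr -big_split /=; apply: eq_bigr => s _.
by rewrite mulrDl mulrA.
Qed.

Lemma actZ h c f v : act h (fun s => c * f s) v = c * act h f v.
Proof.
by rewrite /act mulr_sumr; apply: eq_bigr => s _; rewrite mulrA.
Qed.

Lemma act_linU c h g f v : act (c *: h + g) f v = c * act h f v + act g f v.
Proof.
rewrite /act mulr_sumr -big_split /=; apply: eq_bigr => s _.
by rewrite pairing_linl mulrDr mulrCA.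
Qed.

Lemma act1 f v : act 1 f v = f v.
Proof.
rewrite /act (sum_words_delta (s := v)) // => [|s hs /negPf sv].
  by rewrite P1mon // eqxx mulr1.
by rewrite P1mon // sv mulr0.
Qed.

Lemma actM h g f v : act (h * g) f v = act g (act h f) v.
Proof.
rewrite /act.
transitivity (\sum_(s <- words (size v)) \sum_(w <- words (size v))
   f s * (P h (mon s w) * P g (mon w v))).
  apply: eq_words => s hs; rewrite (pairing_mull hpair).
  by rewrite (comul_mon_bilin hs (is_bilin_pair P h g)) mulr_sumr hs.
rewrite exchange_big /=; apply: eq_words => w hw.
by rewrite hw mulr_suml; apply: eq_bigr => s _; rewrite mulrA.
Qed.

Lemma actK r f v : act (K r) f v = t ^ wt r v * f v.
Proof.
rewrite /act (sum_words_delta (s := v)) // => [|s hs /negPf sv].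
  by rewrite PKmon // eqxx mul1r mulrC.
by rewrite PKmon // sv mul0r mulr0.
Qed.

Lemma actK' r f v : act (K' r) f v = t ^ (- wt r v) * f v.
Proof.
rewrite /act (sum_words_delta (s := v)) // => [|s hs /negPf sv].
  by rewrite PK'mon // eqxx mul1r mulrC.
by rewrite PK'mon // sv mul0r mulr0.
Qed.

Lemma actF_cons r f j v : act (F r) f (j :: v) =
  (j == hi r)%:R * (t ^ wt r v * f (lo r :: v)) +
  t ^ (- wt1 r j) * act (F r) (fun s => f (j :: s)) v.
Proof.
rewrite /act /= sum_wordsS.
transitivity (\sum_i (i == lo r)%:R * ((j == hi r)%:R * (t ^ wt r v * f (i :: v)))
  + \sum_i (i == j)%:R * (t ^ (- wt1 r i) * \sum_(s <- words (size v))
       f (i :: s) * P (F r) (mon s v))).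
  rewrite -big_split /=; apply: eq_bigr => i _.
  transitivity (\sum_(s <- words (size v))
     ((s == v)%:R * (((i == lo r) && (j == hi r))%:R * (t ^ wt r s * f (i :: s)))
     + (i == j)%:R * t ^ (- wt1 r i) * (f (i :: s) * P (F r) (mon s v)))).
    by apply: eq_words => s hs; rewrite PF_cons //; ring.
  rewrite big_split /=; congr (_ + _).
    rewrite (sum_words_delta (s := v)) // => [|s hs /negPf ->]; last by rewrite mul0r.
    by rewrite eqxx mul1r -mulnb natrM -mulrA.
  by rewrite -mulr_sumr mulrA.
congr (_ + _).
  rewrite (bigD1 (lo r)) //= eqxx mul1r big1 ?addr0 // => i /negPf ->.
  by rewrite mul0r.
rewrite (bigD1 j) //= eqxx mul1r [X in _ + X]big1 ?addr0 // => i /negPf ->.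
by rewrite mul0r.
Qed.

Definition ip n (f g : word -> C) : C := \sum_(s <- words n) f s * (g s)^*%R.

Lemma ip_eqw n f f' g g' : eqw n f f' -> eqw n g g' -> ip n f g = ip n f' g'.
Proof. by move=> ff gg; apply: eq_words => s hs; rewrite ff ?gg. Qed.

Lemma ipC n f g : (ip n f g)^*%R = ip n g f.
Proof.
rewrite /ip rmorph_sum; apply: eq_bigr => s _.
by rewrite rmorphM /= conjCK mulrC.
Qed.

Lemma ipZl n c f g : ip n (fun s => c * f s) g = c * ip n f g.
Proof. by rewrite /ip mulr_sumr; apply: eq_bigr => s _; rewrite mulrA. Qed.

Lemma ip_ge0 n f : 0 <= ip n f f.
Proof. by apply: sumr_ge0 => s _; exact: mul_conjC_ge0. Qed.

Lemma ip_eq0 n f : ip n f f = 0 -> forall s, size s = n -> f s = 0.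
Proof.
move/eqP; rewrite /ip psumr_eq0 => [/allP h s hs|s _]; last exact: mul_conjC_ge0.
have := h s; rewrite mem_words hs eqxx => /(_ isT) /=.
by rewrite mul_conjC_eq0 => /eqP.
Qed.

Lemma ip_adjF n r f g : ip n (act (F r) f) g = ip n f (act (E r) g).
Proof.
rewrite /ip /act.
transitivity (\sum_(s <- words n) \sum_(v <- words n)
   f v * P (F r) (mon v s) * (g s)^*%R).
  by apply: eq_words => s hs; rewrite hs mulr_suml.
rewrite exchange_big; apply: eq_words => v hv; rewrite hv rmorph_sum mulr_sumr.
apply: eq_words => s hs; have [e1 e2] := @PE_PF r v s (etrans hv (esym hs)).
by rewrite rmorphM /= e1 e2; ring.
Qed.

Lemma ip_adjE n r f g : ip n (act (E r) f) g = ip n f (act (F r) g).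
Proof. by rewrite -ipC -ip_adjF ipC. Qed.

Lemma ip_adjK n r f g : ip n (act (K r) f) g = ip n f (act (K r) g).
Proof.
apply: eq_words => s hs; rewrite !actK rmorphM /= (conj_gt0 (tX_gt0 _)); ring.
Qed.

Definition phi (J : word) (f : word -> C) : A :=
  \sum_(s <- words (size J)) f s *: mon s J.

Lemma phi_lin J c f g : phi J (fun s => c * f s + g s) = c *: phi J f + phi J g.
Proof.
rewrite /phi scaler_sumr -big_split /=; apply: eq_bigr => s _.
by rewrite scalerDl scalerA.
Qed.

Lemma ract_phi J h f : ract P (phi J f) h = phi J (act h f).
Proof.
rewrite /phi ract_sum /act.
transitivity (\sum_(s <- words (size J)) \sum_(w <- words (size J))
    (f s * P h (mon s w)) *: mon w J).
  apply: eq_words => s hs; rewrite ractZ /Defs.ract.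
  rewrite (comul_mon_bilin hs (is_bilin_act P h)) scaler_sumr hs.
  by apply: eq_bigr => w _; rewrite scalerA.
rewrite exchange_big /=; apply: eq_words => w hw.
by rewrite hw scaler_suml.
Qed.

(** * Lowest weight vectors of U_q(sl_2) *)

Section Sl2String.
Variables (r : 'I_l) (n : nat) (x : word -> C) (m : int).
Hypothesis x_low : eqw n (act (F r) x) (fun _ => 0).
Hypothesis x_wt : forall s, size s = n -> x s != 0 -> wt r s = m.

Let v k := iter k (act (E r)) x.
Let cq : C := ((q - q^-1)^-1)%:C.
Let qn (a : int) : C := cq * (t ^ (a + a) - t ^ (- (a + a))).

Lemma act0 h f : eqw n f (fun _ => 0) -> eqw n (act h f) (fun _ => 0).
Proof.
move=> f0 s hs; rewrite (act_eqw h f0) // /act big1 // => w _.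
by rewrite mul0r.
Qed.

Lemma iter_act0 h k f : eqw n f (fun _ => 0) ->
  eqw n (iter k (act h) f) (fun _ => 0).
Proof. by move=> f0; elim: k => //= k IH; apply: act0. Qed.

Lemma sl2_wt k s : size s = n -> t ^ wt r s * v k s = t ^ (m - k%:Z * 2) * v k s.
Proof.
elim: k s => [|k IH] s hs.
  rewrite mul0r subr0 /v /=.
  by have [->|x0] := eqVneq (x s) 0; rewrite ?mulr0 // x_wt.
rewrite -actK /v iterS -/(v k) -actM (Uq_EK hrel).
rewrite -[X in act X]addr0 act_linU actM.
have -> : act (E r) (act (K r) (v k)) s = t ^ (m - k%:Z * 2) * act (E r) (v k) s.
  rewrite (@act_eqw n (E r) _ (fun w => t ^ (m - k%:Z * 2) * v k w)) //.
    by rewrite actZ.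
  by move=> w hw; rewrite actK IH.
have -> : act 0 (v k) s = 0.
  rewrite /act big1 // => w _.
  have := pairing_linl P (-1) 0 0 (mon w s).
  by rewrite scaler0 addr0 mulN1r addNr => ->; rewrite mulr0.
rewrite addr0 mulrA; congr (_ * _).
have -> : m - k.+1%:Z * 2 = m - k%:Z * 2 - 2 by rewrite -addn1 PoszD; ring.
rewrite [RHS](tXD (m - k%:Z * 2)) [RHS]mulrC; congr (_ * _).
rewrite fmorphV; congr (_^-1); exact: esym t_sqr.
Qed.

Lemma sl2_wtV k s : size s = n ->
  t ^ (- wt r s) * v k s = t ^ (- (m - k%:Z * 2)) * v k s.
Proof.
move=> hs; have [->|v0] := eqVneq (v k s) 0; first by rewrite !mulr0.
have := sl2_wt k hs => /(mulIf v0) e.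
by rewrite -!invr_expz e.
Qed.

Lemma sl2_step k s : size s = n ->
  act (F r) (v k.+1) s = act (E r) (act (F r) (v k)) s + qn (m - k%:Z * 2) * v k s.
Proof.
move=> hs; rewrite {1}/v iterS -/(v k) -!actM.
have := Uq_EF hrel r r; rewrite eqxx => /eqP; rewrite subr_eq => /eqP ->.
rewrite act_linU addrC; congr (_ + _).
rewrite -mulrA; congr (_ * _).
have -> : K r ^+ 2 - K' r ^+ 2 = -1 *: (K' r ^+ 2) + K r ^+ 2.
  by rewrite scaleN1r addrC.
rewrite act_linU !expr2 !actM !actK !actK' mulN1r addrC.
rewrite !(tXD (m - _)) (opprD (m - k%:Z * 2)) (tXD (- (m - k%:Z * 2))).
by rewrite mulrBl -!mulrA !sl2_wt // !sl2_wtV // mulrCA sl2_wt // [X in _ - X]mulrCA sl2_wtV.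
Qed.

Let al k : C := \sum_(i < k) qn (m - i%:Z * 2).

Lemma sl2_F k s : size s = n -> act (F r) (v k.+1) s = al k.+1 * v k s.
Proof.
elim: k s => [|k IH] s hs; rewrite sl2_step //.
  by rewrite (act0 _ x_low) // add0r /al big_ord_recl big_ord0 !addr0.
rewrite (@act_eqw n (E r) _ (fun w => al k.+1 * v k w)) // actZ.
by rewrite /al [in RHS]big_ord_recr /= mulrDl.
Qed.

Lemma sl2_norm k : ip n (v k.+1) (v k.+1) = (al k.+1)^*%R * ip n (v k) (v k).
Proof.
rewrite {1}/v iterS -/(v k) ip_adjE.
have h : eqw n (act (F r) (v k.+1)) (fun s => al k.+1 * v k s).
  by move=> s hs; exact: sl2_F.
rewrite (@ip_eqw n (v k) (v k) _ _ (fun _ _ => erefl) h).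
by rewrite -ipC ipZl rmorphM /= ipC.
Qed.

Lemma cq_lt0 : cq < 0.
Proof.
rewrite ltcR invr_lt0 subr_lt0 (lt_trans hq1) //.
by rewrite invf_gt1.
Qed.

Lemma t_lt1 : t < 1.
Proof. by rewrite ltcR -sqrtr1 ltr_sqrt. Qed.

Lemma qn_lt0 (a : int) : a < 0 -> qn a < 0.
Proof.
case: a => // k _; rewrite NegzE.
rewrite /qn nmulr_rlt0 ?cq_lt0 // subr_gt0.
rewrite -opprD opprK -PoszD -invr_expz.
have h : t ^+ (k.+1 + k.+1) < 1.
  by rewrite exprn_ilt1 ?t_lt1 ?ltW ?t_gt0.
rewrite (lt_trans h) // invf_gt1 //; exact: tX_gt0.
Qed.

Lemma qnN a : qn (- a) = - qn a.
Proof.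
have e : - a - a = - (a + a) by ring.
by rewrite /qn e opprK -[RHS]mulrN opprB.
Qed.

Lemma al_real k : (al k)^*%R = al k.
Proof.
rewrite /al rmorph_sum; apply: eq_bigr => i _.
rewrite rmorphM rmorphB /= !(conj_gt0 (tX_gt0 _)); congr (_ * _).
by apply/CrealP/ltr0_real/cq_lt0.
Qed.

(** The squared norm of E^k x is that of x times the product of the first k
    partial sums of [m] + [m - 2] + [m - 4] + ....  The first of them is [m], so
    m is not negative; then E^(m+1) x = 0 because [m], [m - 2], ..., [-m] add up
    to 0. *)
Lemma sl2_string : (exists2 s, size s = n & x s != 0) ->
  0 <= m /\ forall k : nat, m < k%:Z -> eqw n (iter k (act (E r)) x) (fun _ => 0).
Proof.
move=> [s0 hs0 xs0].
have m0 : 0 <= m.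
  rewrite leNgt; apply/negP => m0.
  have := ip_ge0 n (v 1); rewrite sl2_norm al_real /al big_ord_recl big_ord0.
  rewrite mul0r subr0 addr0 nmulr_rge0 ?qn_lt0 // => h.
  have /ip_eq0 /(_ _ hs0) : ip n (v 0) (v 0) = 0.
    by apply/le_anti; rewrite h ip_ge0.
  by move/eqP; rewrite (negPf xs0).
split=> // k; case: m m0 @al sl2_norm => // m' _ al' nrm.
rewrite ltz_nat => mk.
have : al' m'.+1 = 0.
  apply/eqP; rewrite -[_ == 0]/((2 == 0)%N || _) -mulrn_eq0 mulr2n addr_eq0 /al'; apply/eqP.
  (* Reversing the sum changes the sign of each term. *)
  rewrite [LHS](reindex_inj rev_ord_inj) /= -sumrN; apply: eq_bigr => i _.
  rewrite -qnN subSS; congr (qn _); have := ltn_ord i; lia.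
move=> a0; have /ip_eq0 h : ip n (v m'.+1) (v m'.+1) = 0.
  by rewrite nrm a0 rmorph0 mul0r.
by rewrite -(subnK mk) iterD; apply: iter_act0.
Qed.

End Sl2String.

(** * Lowest weight vectors in products of symmetric powers *)

(** Orthogonality to the relations u^i_c u^j_c = q u^j_c u^i_c, i < j: inside a
    run of equal columns, permuting the letters rescales the coefficient. *)
Definition qsym (J : word) (f : word -> C) : Prop :=
  forall s1 s2 (i j : letter) J1 c J2, J = J1 ++ [:: c, c & J2] ->
    size s1 = size J1 -> size s2 = size J2 -> (i < j)%N ->
    f (s1 ++ [:: i, j & s2]) = q%:C * f (s1 ++ [:: j, i & s2]).

Lemma qsym_behead c J f i : qsym (c :: J) f -> qsym J (fun s => f (i :: s)).
Proof.
move=> h s1 s2 a b J1 d J2 eJ h1 h2 ab.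
by apply: (h (i :: s1) s2 a b (c :: J1) d J2) => //=; rewrite ?eJ ?h1.
Qed.

Lemma qsym_drop J0 J f B : size B = size J0 -> qsym (J0 ++ J) f ->
  qsym J (fun s => f (B ++ s)).
Proof.
elim: B J0 f => [|i B IH] [|c J0] f //= [hs] h.
by apply: (IH J0 (fun s => f (i :: s))) => //; apply: qsym_behead h.
Qed.

Lemma qC_gt0 : 0 < q%:C :> C. Proof. by rewrite ltcR. Qed.

Definition proportional (B B' : word) : Prop := size B = size B' /\
  forall c J f, qsym (nseq (size B) c ++ J) f ->
  exists2 a : C, 0 < a & forall s, size s = size J -> f (B ++ s) = a * f (B' ++ s).

(** An adjacent exchange costs q or its inverse.  The positivity of the factor
    rules out cancellations when F_r is applied to a block. *)
Lemma perm_proportional B B' : perm_eq B B' -> proportional B B'.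
Proof.
move: B B'; apply: perm_eq_ind.
- by move=> s; split=> // c J f _; exists 1 => // s' _; rewrite mul1r.
- move=> s v w [sv h1] [vw h2]; split; first by rewrite sv.
  move=> c J f hf; have [a a0 ha] := h1 _ _ _ hf.
  rewrite sv in hf; have [b b0 hb] := h2 _ _ _ hf.
  by exists (a * b); [rewrite mulr_gt0 | move=> x hx; rewrite ha // hb // mulrA].
- move=> i s v [sv h]; split; first by rewrite /= sv.
  move=> c J f /= hf; have [a a0 ha] := h c J _ (@qsym_behead _ _ _ i hf).
  by exists a.
- move=> i j s; split=> // c J f /= hf.
  case: (ltngtP i j) => [ij|ji|/val_inj ->].
  + exists q%:C; first exact: qC_gt0.
    move=> v hv; apply: (hf [::] (s ++ v) i j [::] c (nseq (size s) c ++ J)) => //.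
    by rewrite !size_cat size_nseq hv.
  + exists (q%:C)^-1; first by rewrite invr_gt0 qC_gt0.
    move=> v hv.
    have := hf [::] (s ++ v) j i [::] c (nseq (size s) c ++ J) erefl erefl.
    rewrite !size_cat size_nseq hv => /(_ erefl ji) /= ->.
    by rewrite mulKf // gt_eqF // qC_gt0.
  + by exists 1 => // v _; rewrite mul1r.
Qed.

Lemma wt_cat r s v : wt r (s ++ v) = wt r s + wt r v.
Proof. rewrite /wt !count_cat !PoszD; ring. Qed.

(** F_r changes one letter of a word at a time.  The terms that change a letter
    of the first block differ by rearrangements of that block, so that they add
    up, without cancellation, to a single one. *)
Lemma actF_block r c B J f : qsym (nseq (size B) c ++ J) f ->
  exists a : C, (if hi r \in B then 0 < a else a == 0) /\
  forall s, size s = size J -> act (F r) f (B ++ s) =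
    t ^ (- wt r B) * act (F r) (fun v => f (B ++ v)) s +
    a * t ^ wt r s * f (lo r :: rem (hi r) B ++ s).
Proof.
elim: B f => [|j B IH] f hf.
  exists 0; rewrite eqxx; split=> // s _.
  by rewrite !mul0r addr0 /wt /= subrr oppr0 expr0z mul1r.
have [a1 [ha1 e1]] := IH _ (@qsym_behead _ _ _ j hf).
have W s : t ^ (- wt1 r j) * (t ^ (- wt r B) * s) = t ^ (- wt r (j :: B)) * s.
  by rewrite mulrA -tXD wt_cons (opprD (wt1 r j)).
rewrite inE; have [jh|jh] := eqVneq (hi r) j.
  subst j; rewrite /= eqxx.
  have [hB|hB] := boolP (hi r \in B).
    rewrite hB in ha1.
    have pe : perm_eq (hi r :: lo r :: rem (hi r) B) (lo r :: B).
      rewrite -cat1s -[lo r :: rem _ _]cat1s perm_catCA /= perm_cons.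
      by rewrite perm_sym perm_to_rem.
    have hs : size (hi r :: lo r :: rem (hi r) B) = size (lo r :: B).
      exact: perm_size.
    have [_ pp] := perm_proportional pe.
    have [] := pp c J f; first by rewrite hs.
    move=> b b0 hb.
    exists (t ^ wt r B + t ^ (- wt1 r (hi r)) * a1 * b); split.
      by rewrite addr_gt0 // ?mulr_gt0 ?tX_gt0.
    move=> s sJ; rewrite actF_cons eqxx mul1r e1 //= hb // mulrDr W.
    rewrite wt_cat tXD /=; ring.
  rewrite (negPf hB) in ha1; exists (t ^ wt r B); split; first exact: tX_gt0.
  move=> s sJ; rewrite actF_cons eqxx mul1r e1 //= (eqP ha1) !mul0r addr0 W.
  by rewrite wt_cat tXD [LHS]addrC.
have jh' := negPf jh; rewrite eq_sym in jh'.
rewrite /= jh'; have [hB|hB] := boolP (hi r \in B).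
  rewrite hB in ha1.
  have pe : perm_eq (j :: lo r :: rem (hi r) B) (lo r :: j :: rem (hi r) B).
    by rewrite -cat1s -[lo r :: rem _ _]cat1s perm_catCA.
  have hs : size (j :: lo r :: rem (hi r) B) = size (j :: B).
    by rewrite /= size_rem //; case: (B) hB.
  have [_ pp] := perm_proportional pe.
  have [] := pp c J f; first by rewrite hs.
  move=> b b0 hb.
  exists (t ^ (- wt1 r j) * a1 * b); split; first by rewrite !mulr_gt0 ?tX_gt0.
  move=> s sJ; rewrite actF_cons jh' mul0r add0r e1 //= hb // mulrDr W /=; ring.
rewrite (negPf hB) in ha1; exists 0; split; first by rewrite eqxx.
by move=> s sJ; rewrite actF_cons jh' mul0r add0r e1 //= (eqP ha1) !mul0r !addr0 W.
Qed.

Definition lowest n f := forall r, eqw n (act (F r) f) (fun _ => 0).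
Definition supp n (lam : letter -> nat) (f : word -> C) :=
  forall s, size s = n -> f s != 0 -> forall i, count_mem i s = lam i.
Definition nonzero n (f : word -> C) := exists2 s : word, size s = n & f s != 0.

Section Block.
Variables (c : letter) (J : word) (d : nat) (f : word -> C) (lam : letter -> nat).
Hypothesis fsym : qsym (nseq d c ++ J) f.
Hypothesis flow : lowest (d + size J) f.
Hypothesis fsupp : supp (d + size J) lam f.

(** For a lowest weight vector, the two contributions of [actF_block] cancel.
    The powers of t are constant because the weight is fixed. *)
Lemma block_F r B : size B = d -> hi r \in B ->
  exists2 a : C, a != 0 & eqw (size J) (fun s => f (lo r :: rem (hi r) B ++ s))
    (fun s => a * act (F r) (fun v => f (B ++ v)) s).
Proof.
move=> hB rB.
have [|a [ha e]] := @actF_block r c B J f; first by rewrite hB.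
rewrite rB in ha.
have sz s : size s = size J ->
    size (lo r :: rem (hi r) B ++ s) = (d + size J)%N.
  move=> hs; rewrite /= size_cat size_rem // hs hB.
  by case: (d) hB rB => [/size0nil ->|].
pose g s := f (lo r :: rem (hi r) B ++ s).
have e2 s : size s = size J ->
    a * t ^ wt r s * g s = - (t ^ (- wt r B) * act (F r) (fun v => f (B ++ v)) s).
  move=> hs; apply/eqP; rewrite -addr_eq0 addrC -e // flow ?eqxx //.
  by rewrite size_cat hB hs.
pose m : int := ((lam (hi r))%:Z - (lam (lo r))%:Z) -
  wt r (lo r :: rem (hi r) B).
have em s : size s = size J -> g s != 0 -> wt r s = m.
  move=> hs gs; have hl := fsupp (sz s hs) gs.
  have : wt r (lo r :: rem (hi r) B ++ s) = (lam (hi r))%:Z - (lam (lo r))%:Z.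
    by rewrite {1}/wt !hl.
  by rewrite -cat_cons wt_cat /m => <-; rewrite addrC addKr.
exists (- (t ^ (- wt r B) / (a * t ^ m))).
  by rewrite oppr_eq0 mulf_neq0 ?invr_neq0 ?mulf_neq0 ?tX_neq0 ?gt_eqF.
move=> s hs; rewrite -/(g s).
have {}e2 := e2 s hs.
have am : a * t ^ m != 0 by rewrite mulf_neq0 ?tX_neq0 ?gt_eqF.
have [g0|gn] := eqVneq (g s) 0.
  move/eqP: e2; rewrite g0 mulr0 eq_sym oppr_eq0 mulf_eq0 (negPf (tX_neq0 _)) /=.
  by move=> /eqP ->; rewrite mulr0.
rewrite em // in e2.
by apply: (mulfI am); rewrite e2 mulNr mulrN mulrA [_ * (_ / _)]mulrCA mulfV ?mulr1.
Qed.

(** Iterates [block_F], moving F_r to the other side of the inner product each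
    time a letter lo r of the block is traded for hi r. *)
Lemma block_ip r B : size B = d -> exists y (a : C), forall g,
  ip (size J) (fun s => f (B ++ s)) g =
  a * ip (size J) y (iter (count_mem (lo r) B) (act (E r)) g).
Proof.
move: {2}(count_mem _ _) (erefl (count_mem (lo r) B)) => k.
elim: k B => [|k IH] B hk hB.
  by exists (fun s => f (B ++ s)), 1 => g; rewrite hk mul1r.
have lB : lo r \in B by rewrite -has_pred1 has_count hk.
pose B1 := hi r :: rem (lo r) B.
have hB1 : size B1 = d.
  by rewrite /= size_rem // -hB; case: (B) lB.
have hk1 : count_mem (lo r) B1 = k.
  have := seq.permP (perm_to_rem lB) (pred1 (lo r)); rewrite hk /= eqxx /= add1n.
  by move=> [<-]; rewrite eq_sym (negPf (lo_hi r)).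
have [a a0 ha] := @block_F r B1 hB1 (mem_head _ _).
have pe : perm_eq B (lo r :: rem (hi r) B1) by rewrite /= eqxx perm_to_rem.
have [_ /(_ c J f)] := perm_proportional pe; rewrite hB => /(_ fsym) [b b0 hb].
have [y [a' hy]] := IH B1 hk1 hB1.
exists y, (b * a * a') => g.
transitivity (b * a * ip (size J) (act (F r) (fun v => f (B1 ++ v))) g).
  rewrite -ipZl; apply: ip_eqw => // s hs; rewrite hb // ha //; ring.
by rewrite ip_adjF hy hk hk1 iterSr mulrA.
Qed.

(** Choosing B with the smallest sum of letters kills every other term of the
    lowest weight equation, so the coefficient of B is again a lowest weight
    vector.  It is also, up to a scalar, the image under a power of F_r of the
    coefficient of the block where all letters lo r of B have become hi r.  The
    length of its E_r-string bounds that power, which is the condition that the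
    letters of B form a horizontal strip. *)
Lemma block_step : nonzero (d + size J) f ->
  exists B, [/\ size B = d, nonzero (size J) (fun s => f (B ++ s)),
    lowest (size J) (fun s => f (B ++ s)),
    supp (size J) (fun i => lam i - count_mem i B)%N (fun s => f (B ++ s)) &
    (forall i, count_mem i B <= lam i)%N /\
    (forall r, count_mem (hi r) B + lam (lo r) <= lam (hi r))%N].
Proof.
move=> [w hw fw].
pose ls (B : word) := sumn (map val B).
pose Q k := `[< exists B, [/\ size B = d, ls B = k & nonzero (size J) (fun s => f (B ++ s))] >].
have Qex : exists k, Q k.
  exists (ls (take d w)); apply/asboolP; exists (take d w).
  have hd : size (take d w) = d by rewrite size_takel // hw leq_addr.
  split=> //; exists (drop d w); first by rewrite size_drop hw addKn.
  by rewrite cat_take_drop.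
have [k /asboolP [B [hB Bk nzB]] kmin] := ex_minnP Qex.
have small B' s : size B' = d -> size s = size J -> (ls B' < k)%N -> f (B' ++ s) = 0.
  move=> hB' hs lt; apply/eqP; apply: contraTT lt => fn; rewrite -leqNgt.
  by apply: kmin; apply/asboolP; exists B'; split=> //; exists s.
have low : lowest (size J) (fun s => f (B ++ s)).
  move=> r s hs; have [|a [ha e]] := @actF_block r c B J f; first by rewrite hB.
  have := e s hs; rewrite flow; last by rewrite size_cat hB hs.
  have [rB|rB] := boolP (hi r \in B).
    rewrite -cat_cons small ?mulr0 ?addr0 //.
    - by move/esym/eqP; rewrite mulf_eq0 (negPf (tX_neq0 _)) => /eqP.
    - by rewrite /= size_rem // -hB; case: (B) rB.
    - rewrite -Bk /ls (perm_sumn (perm_map val (perm_to_rem rB))) /=.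
      by rewrite ltn_add2r /bump.
  rewrite (negPf rB) in ha; rewrite (eqP ha) !mul0r addr0.
  by move/esym/eqP; rewrite mulf_eq0 (negPf (tX_neq0 _)) => /eqP.
have cnt s i : size s = size J -> f (B ++ s) != 0 ->
    (count_mem i B + count_mem i s)%N = lam i.
  by move=> hs fs; rewrite -count_cat (fsupp _ fs) // size_cat hB hs.
have le i : (count_mem i B <= lam i)%N.
  by case: nzB => s hs fs; rewrite -(cnt s) // leq_addr.
have sp : supp (size J) (fun i => lam i - count_mem i B)%N (fun s => f (B ++ s)).
  by move=> s hs fs i; rewrite -(cnt s i) // addKn.
exists B; split=> //; split=> // r.
pose m : int := (lam (hi r) - count_mem (hi r) B)%N%:Z
              - (lam (lo r) - count_mem (lo r) B)%N%:Z.
have [|m0 str] := @sl2_string r (size J) (fun s => f (B ++ s)) m (low r) _ nzB.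
  by move=> s hs fs; rewrite /wt !(sp s hs fs).
have := le (hi r); have := le (lo r).
case: (leqP (count_mem (hi r) B + lam (lo r)) (lam (hi r))) => // gt le1 le2.
have [y [a ha]] := @block_ip r B hB.
have := ha (fun s => f (B ++ s)).
rewrite (@ip_eqw _ _ y _ (fun _ => 0) (fun _ _ => erefl)); last first.
  by apply: str; rewrite /m; lia.
rewrite [X in _ = a * X]/ip big1 ?mulr0 => [|s _]; last by rewrite conjC0 mulr0.
by move/ip_eq0 => z0; case: nzB => s hs; rewrite z0 // eqxx.
Qed.

End Block.

Definition blocks (bs : seq (nat * letter)) : word :=
  flatten [seq nseq x.1 x.2 | x <- bs].

(** A tableau filled with a given number of letters has at most that many rows:
    each horizontal strip adds at most one. *)
Lemma lowest_rows bs f lam : qsym (blocks bs) f -> lowest (size (blocks bs)) f ->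
  supp (size (blocks bs)) lam f -> nonzero (size (blocks bs)) f ->
  forall i : letter, (i + size bs < l.+1)%N -> lam i = 0%N.
Proof.
elim: bs f lam => [|[d c] bs IH] f lam /=.
  by move=> _ _ sp [s hs fs] i _; rewrite -(sp s hs fs) (size0nil hs).
rewrite size_cat size_nseq => sy lo_ sp nz i hi_.
have [B [hB nzB loB spB [leB hor]]] := block_step sy lo_ sp nz.
have /IH hz : qsym (blocks bs) (fun s => f (B ++ s)).
  by apply: qsym_drop sy; rewrite size_nseq.
have il : (i < l)%N by lia.
pose r := Ordinal il.
have er : lo r = i by apply: val_inj.
have eh : val (hi r) = i.+1 by [].
have := hz _ loB spB nzB (hi r); rewrite eh => /(_ ltac:(lia)).
have := hor r; have := leB (hi r); rewrite er; lia.
Qed.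

(** The only tableau of shape (k, ..., k, k + N): the block followed by m others
    puts k boxes in row l - m and its remaining boxes in the last row. *)
Fixpoint lead (k : nat) (bs : seq (nat * letter)) : word :=
  if bs is x :: bs' then
    (nseq k (inord (l - size bs')) ++ nseq (x.1 - k) ord_max) ++ lead k bs'
  else [::].

Lemma sum_count (s : word) : (\sum_i count_mem i s)%N = size s.
Proof.
elim: s => [|j s IH] /=; first by rewrite big1.
rewrite big_split /= IH (bigD1 j) //= eqxx big1 // => i ij.
by rewrite eq_sym (negPf ij).
Qed.

Lemma count_perm (s v : word) :
  (forall i, count_mem i s = count_mem i v) -> perm_eq s v.
Proof. by move=> h; apply/allP => i _ /=; rewrite h. Qed.

(** By [block_step] and [lowest_rows], the content of the first block is forced,
    and what remains is a weight of the same form with one row less. *)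
Lemma lowest_lead k bs f lam : (size bs <= l.+1)%N ->
  qsym (blocks bs) f -> lowest (size (blocks bs)) f ->
  supp (size (blocks bs)) lam f -> nonzero (size (blocks bs)) f ->
  (forall i : letter, (i < l)%N -> lam i = if (i + size bs < l.+1)%N then 0%N else k) ->
  (0 < size bs -> k <= lam ord_max)%N ->
  all (fun x => k <= x.1)%N bs && (f (lead k bs) != 0).
Proof.
elim: bs f lam => [|[d c] bs IH] f lam /=.
  by move=> _ _ _ _ [s hs fs] _ _; rewrite -(size0nil hs).
rewrite ltnS size_cat size_nseq => sz sy lo_ sp nz lamE lamM.
have {}lamM := lamM isT.
(* Row l - size bs is emptied by the first block, and the rows between it and
   the last one cannot be touched by a horizontal strip. *)
have [B [hB nzB loB spB [leB hor]]] := block_step sy lo_ sp nz.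
have sy' : qsym (blocks bs) (fun s => f (B ++ s)).
  by apply: qsym_drop sy; rewrite size_nseq.
have hz := lowest_rows sy' loB spB nzB.
pose i0 : letter := inord (l - size bs).
have vi0 : i0 = (l - size bs)%N :> nat by rewrite inordK // ltnS leq_subr.
have prev (i : letter) : (0 < i)%N ->
    exists2 i' : letter, i' = i.-1 :> nat & (count_mem i B + lam i' <= lam i)%N.
  move=> ip0; have il : (i.-1 < l)%N by have := ltn_ord i; lia.
  exists (lo (Ordinal il)) => //.
  have e : hi (Ordinal il) = i.
    by apply: val_inj; rewrite /= /bump /= add1n prednK.
  by have := hor (Ordinal il); rewrite e.
have cB (i : letter) : i != ord_max -> count_mem i B = if i == i0 then k else 0%N.
  move=> im; have il : (i < l)%N.
    by have := ltn_ord i; rewrite ltnS leq_eqVlt => /orP [/eqP e|//]; case/eqP: im; apply: val_inj.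
  have := lamE i il; have := leB i; have := hz i.
  case: eqP => [->|/eqP]; rewrite ?vi0.
    case: ifP; first by lia.
    move=> _ h1 h2 h3; move: (h1 ltac:(lia)); lia.
  rewrite -val_eqE /= vi0 => ne.
  case: ifP => [_ _ ? ?|nlt _ _ e]; first by lia.
  have [|i' vi' le] := prev i; first by lia.
  have := lamE i'; rewrite vi' => /(_ ltac:(lia)).
  case: ifP => [|_ e']; first by lia.
  by move: le; rewrite e e' -{2}[k]add0n leq_add2r leqn0 => /eqP.
have dk : (k <= d)%N /\ count_mem ord_max B = if ord_max == i0 then d else (d - k)%N.
  have := sum_count B; rewrite hB (bigD1 ord_max) //=.
  have [e|ne] := eqVneq ord_max i0.
    rewrite big1 => [|i im]; last by rewrite cB // -e (negPf im).
    rewrite addn0 => cd; split=> //.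
    case: nzB => s hs fs; have h := spB s hs fs ord_max.
    have : size bs = 0%N.
      by move/(congr1 (@nat_of_ord _)): e; rewrite vi0 /= => e; lia.
    move=> /size0nil eb; have h2 := hs; rewrite eb in h2.
    rewrite (size0nil h2) /= cd in h.
    by rewrite (leq_trans lamM) // -subn_eq0 -h.
  rewrite (bigD1 i0) 1?eq_sym //= big1 => [|i /andP [im ii]]; last first.
    by rewrite cB // (negPf ii).
  have -> : count_mem i0 B = k by rewrite cB ?eqxx // eq_sym.
  by rewrite addn0 => <-; rewrite addnK; split=> //; rewrite leq_addl.
have [kd cM] := dk; rewrite kd /=.
have pe : perm_eq B (nseq k i0 ++ nseq (d - k) ord_max).
  apply: count_perm => i; rewrite count_cat !count_nseq /=.
  have [->|im] := eqVneq i ord_max.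
    by rewrite cM mul1n eq_sym; case: eqP => _; rewrite ?mul1n ?mul0n ?add0n // subnKC.
  by rewrite cB // [i0 == i]eq_sym; case: eqP => _; rewrite ?mul1n !mul0n addn0.
have [_ /(_ c (blocks bs) f)] := perm_proportional pe.
rewrite hB => /(_ sy) [a a0 ha].
have [|||al nl] := andP (IH _ _ _ sy' loB spB nzB _ _).
- by lia.
- move=> i il /=; rewrite lamE // cB; last by rewrite -val_eqE /=; lia.
  rewrite -val_eqE /= vi0.
  by case: ifP; case: ifP; case: ifP; lia.
- move=> bs0; rewrite cM.
  have [|i' vi' le] := prev ord_max; first by rewrite /=; lia.
  have := lamE i'; rewrite vi' /= => /(_ ltac:(lia)).
  have -> : (ord_max == i0) = false by apply/negP => /eqP /(congr1 (@nat_of_ord _)); rewrite vi0 /=; lia.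
  rewrite cM in le; move: le.
  have -> : (ord_max == i0) = false by apply/negP => /eqP /(congr1 (@nat_of_ord _)); rewrite vi0 /=; lia.
  case: ifP; lia.
rewrite al /=; apply: contraNneq nl => e0.
have sl : size (lead k bs) = size (blocks bs).
  elim: (bs) al => //= -[d' c'] bs' IH' /= /andP [kd' /IH' e].
  by rewrite !size_cat !size_nseq e subnKC.
by rewrite ha // -[_ ++ lead k bs]/(_ ++ _) e0 mulr0.
Qed.

(** * Monomials with prescribed columns *)

Definition colspan (J : word) (a : A) : Prop := exists f, a = phi J f.

Lemma colspan_lin J c a b : colspan J a -> colspan J b -> colspan J (c *: a + b).
Proof.
by move=> [f ->] [g ->]; exists (fun s => c * f s + g s); rewrite phi_lin.
Qed.

Lemma colspan0 J : colspan J 0.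
Proof.
by exists (fun _ => 0); rewrite /phi big1 // => s _; rewrite scale0r.
Qed.

Lemma colspanZ J c a : colspan J a -> colspan J (c *: a).
Proof. by move=> ha; rewrite -[c *: a]addr0; apply: colspan_lin (colspan0 J). Qed.

Lemma colspanD J a b : colspan J a -> colspan J b -> colspan J (a + b).
Proof. by move=> ha; rewrite -[a]scale1r; apply: colspan_lin. Qed.

Lemma colspan_words J n (f : word -> A) :
  (forall s, size s = n -> colspan J (f s)) -> colspan J (\sum_(s <- words n) f s).
Proof.
move=> h; rewrite big_seq; elim/big_ind: _ => [|a b|s].
- exact: colspan0.
- exact: colspanD.
- by rewrite mem_words => /eqP; apply: h.
Qed.

Lemma colspan_mon s J : size s = size J -> colspan J (mon s J).
Proof.
move=> hs; exists (fun v => (v == s)%:R); rewrite /phi (sum_words_delta hs).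
  by rewrite eqxx scale1r.
by move=> v _ /negPf ->; rewrite scale0r.
Qed.

Lemma mon_cat s v J L : size s = size J -> mon (s ++ v) (J ++ L) = mon s J * mon v L.
Proof.
elim: s J => [|i s IH] [|j J] //= => [_|[sJ]]; first by rewrite mul1r.
by rewrite IH // mulrA.
Qed.

Lemma colspanM J L a b : colspan J a -> colspan L b -> colspan (J ++ L) (a * b).
Proof.
move=> [f ->] [g ->]; rewrite /phi mulr_suml; apply: colspan_words => s hs.
rewrite mulr_sumr; apply: colspan_words => v hv.
rewrite -scalerAl -scalerAr; do 2!apply: colspanZ.
by rewrite -mon_cat //; apply: colspan_mon; rewrite !size_cat hs hv.
Qed.

Let hsu := SUq_rel hA.

(** The defining relations rewrite a product with columns x, y as a combination
    of products with columns y, x. *)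
Lemma colspan2 i k x y : colspan [:: y; x] (u i x * u k y).
Proof.
have b a c : colspan [:: y; x] (u a y * u c x).
  by have := @colspan_mon [:: a; c] [:: y; x] erefl; rewrite /= mulr1.
have qn0 : q%:C != 0 :> C by rewrite gt_eqF // qC_gt0.
case: (ltngtP x y) => [xy|yx|/val_inj ->]; last first.
- by have := @colspan_mon [:: i; k] [:: y; y] erefl; rewrite /= mulr1.
- case: (ltngtP i k) => [ik|ki|/val_inj ->].
  + by have /eqP := SUq_anti hsu ik yx; rewrite subr_eq0 => /eqP ->.
  + have /eqP := SUq_diag hsu ki yx; rewrite subr_eq addrC -subr_eq => /eqP <-.
    have /eqP := SUq_anti hsu ki yx; rewrite subr_eq0 => /eqP ->.
    by rewrite -scaleNr addrC; apply: colspan_lin.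
  + have -> : u k x * u k y = (q%:C)^-1 *: (u k y * u k x).
      by rewrite (SUq_row hsu k yx) scalerA mulVf // scale1r.
    exact: colspanZ.
- case: (ltngtP i k) => [ik|ki|/val_inj ->].
  + have /eqP := SUq_diag hsu ik xy; rewrite subr_eq => /eqP ->.
    exact: colspan_lin.
  + by have /eqP := SUq_anti hsu ki xy; rewrite subr_eq0 => /eqP <-.
  + by rewrite (SUq_row hsu k xy); apply: colspanZ.
Qed.

Lemma colspan_perm J L : perm_eq J L -> forall a, colspan J a -> colspan L a.
Proof.
move: J L; apply: perm_eq_ind => //.
- by move=> J L M h1 h2 a /h1 /h2.
- move=> x J L h a [f ->]; apply: colspan_words => -[|i s] //= [hs].
  apply: colspanZ; apply: (@colspanM [:: x] L).
    by have := @colspan_mon [:: i] [:: x] erefl; rewrite /= mulr1.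
  by apply: h; apply: colspan_mon.
- move=> x y J a [f ->]; apply: colspan_words => -[|i [|k s]] //= [hs].
  apply: colspanZ; rewrite mulrA; apply: (@colspanM [:: y; x] J).
    exact: colspan2.
  exact: colspan_mon.
Qed.

Definition spanned (a : A) : Prop :=
  exists L : seq (word * (word -> C)), a = \sum_(x <- L) phi x.1 x.2.

Lemma SUq_transfer (B : algType C) (f : {lrmorphism B -> A})
    (v : letter -> letter -> B) :
  injective f -> (forall i j, f (v i j) = u i j) -> SUq_relations q v.
Proof.
move=> fi fv; split.
- by move=> i j k ij; apply: fi; rewrite linearZ !rmorphM /= !fv (SUq_col hsu).
- by move=> i j k ij; apply: fi; rewrite linearZ !rmorphM /= !fv (SUq_row hsu).
- move=> i j k m ij km; apply: fi; rewrite rmorphB !rmorphM /= !fv rmorph0.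
  exact: (SUq_anti hsu).
- move=> i j k m ij km; apply: fi; rewrite linearZ rmorphB !rmorphM /= !fv.
  exact: (SUq_diag hsu).
- apply: fi; rewrite rmorph1 -(SUq_det hsu) rmorph_sum; apply: eq_bigr => p _.
  rewrite /= linearZ rmorph_prod; congr (_ *: _); apply: eq_bigr => i _; exact: fv.
Qed.

(** The combinations of monomials form a subalgebra.  By the universal property
    A maps to it, and the composite with the inclusion fixes every u^i_j, so it
    is the identity. *)
Lemma all_spanned a : spanned a.
Proof.
have [||| B [f [fi fS]]] := @subalg_incl C A spanned.
- exists [:: ([::], fun _ => 1)].
  by rewrite big_seq1 /phi sum_words0 scale1r.
- move=> c x y [L ->] [M ->].
  exists ([seq (z.1, fun s => c * z.2 s) | z <- L] ++ M).
  rewrite big_cat big_map scaler_sumr; congr (_ + _); apply: eq_bigr => z _ /=.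
  by rewrite /phi scaler_sumr; apply: eq_bigr => s _; rewrite scalerA.
- move=> x y [L ->] [M ->].
  have e z z' : exists f, phi z.1 z.2 * phi z'.1 z'.2 = phi (z.1 ++ z'.1) f :> A.
    by apply: colspanM; [exists z.2 | exists z'.2].
  pose h z z' := projT1 (cid (e z z')).
  exists [seq (z.1 ++ z'.1, h z z') | z <- L, z' <- M].
  rewrite big_allpairs_dep mulr_suml; apply: eq_bigr => z _.
  rewrite mulr_sumr; apply: eq_bigr => z' _ /=.
  by rewrite /h; case: cid.
have /(_ _ _)/cid hv i j : exists b, f b = u i j.
  apply/fS; have [g hg] := @colspan_mon [:: i] [:: j] erefl.
  exists [:: ([:: j], g)]; rewrite big_seq1 /= -hg /=.
  by rewrite mulr1.
pose v i j := projT1 (hv i j).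
have fv i j : f (v i j) = u i j by rewrite /v; case: (hv i j).
have [p [pu _]] := SUq_universal hA (SUq_transfer fi fv).
have [p0 [_ p0u]] := SUq_universal hA hsu.
have e1 : f \o p =1 p0.
  by apply: (p0u (f \o p)) => i j /=; rewrite pu.
have e2 : idfun =1 p0 by apply: (p0u idfun).
by apply/fS; exists (p a); rewrite -[LHS]/((f \o p) a) e1 -e2.
Qed.

(** * Monomials in the homogeneous coordinates *)

(** A monomial in the coordinates z_j.  Its factors commute up to powers of q,
    so words are kept instead of exponents. *)
Definition zw (s : word) : A := mon (nseq (size s) ord_max) s.

Lemma zw_cons j s : zw (j :: s) = z u j * zw s. Proof. by []. Qed.

Lemma zw_cat s v : zw (s ++ v) = zw s * zw v.
Proof. by rewrite /zw size_cat nseqD mon_cat // size_nseq. Qed.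

Lemma zw_perm s v : perm_eq s v -> exists2 a : C, 0 < a & zw s = a *: zw v.
Proof.
move: s v; apply: perm_eq_ind.
- by move=> s; exists 1 => //; rewrite scale1r.
- move=> s v w [a a0 ->] [b b0 ->]; exists (a * b); first exact: mulr_gt0.
  by rewrite scalerA.
- by move=> x s v [a a0 e]; exists a => //; rewrite !zw_cons e scalerAr.
- move=> x y s; rewrite !zw_cons !mulrA /z.
  case: (ltngtP x y) => [xy|yx|/val_inj ->].
  + by exists q%:C; [exact: qC_gt0 | rewrite (SUq_row hsu ord_max xy) -scalerAl].
  + exists (q%:C)^-1; first by rewrite invr_gt0 qC_gt0.
    rewrite (SUq_row hsu ord_max yx) -scalerAl scalerA mulVf ?scale1r //.
    by rewrite gt_eqF // qC_gt0.
  + by exists 1 => //; rewrite scale1r.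
Qed.

Lemma lact_u h i j : lact P h (u i j) = \sum_k P h (u k j) *: u i k.
Proof. by rewrite /lact (comul_u_bilin _ _ (is_bilin_lact P h)). Qed.

Lemma lactK_zw r s : lact P (K r) (zw s) = t ^ wt r s *: zw s.
Proof.
elim: s => [|j s IH].
  rewrite /wt subrr expr0z scale1r /lact /zw /=.
  rewrite (tensor2_bilin (is_bilin_lact P (K r)) (@comul1 _ A)) big_seq1 /=.
  by rewrite (pairing1r hpair) (Uq_counitK hU) scale1r.
rewrite zw_cons (lact_grouplike _ _ (@grouplikeK r)) IH lact_u (bigD1 j) //=.
rewrite PKu eqxx mul1r big1 => [|k /negPf kj]; last by rewrite PKu kj mul0r scale0r.
by rewrite addr0 -scalerAl -scalerAr scalerA wt_cons (tXD (wt1 r j)).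
Qed.

(** E_r |> replaces a letter lo r by hi r; all the terms are positive multiples
    of the same monomial. *)
Lemma lactE_zw r s :
  exists a : C, (if lo r \in s then 0 < a else a == 0) /\
    lact P (E r) (zw s) = a *: zw (hi r :: rem (lo r) s).
Proof.
elim: s => [|j s [a1 [ha1 e1]]].
  exists 0; split; first by rewrite eqxx.
  rewrite scale0r /lact /zw /=.
  rewrite (tensor2_bilin (is_bilin_lact P (E r)) (@comul1 _ A)) big_seq1 /=.
  by rewrite (pairing1r hpair) (Uq_counitE hU) scale0r.
have eE : lact P (E r) (z u j) = (j == lo r)%:R *: z u (hi r).
  rewrite lact_u (bigD1 (hi r)) //= PEu eqxx /= big1 ?addr0 // => k /negPf kh.
  by rewrite PEu kh scale0r.
have eK : lact P (K' r) (z u j) = t ^ (- wt1 r j) *: z u j.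
  rewrite lact_u (bigD1 j) //= PK'u eqxx mul1r big1 ?addr0 // => k /negPf kj.
  by rewrite PK'u kj mul0r scale0r.
rewrite zw_cons (lact_skew _ _ (@skewE r)) eE eK e1 lactK_zw.
have mv x w : zw (x :: w) = z u x * zw w by [].
have pe : perm_eq [:: j, hi r & rem (lo r) s] [:: hi r, j & rem (lo r) s].
  by rewrite -cat1s -[hi r :: rem _ _]cat1s perm_catCA.
have [b b0 hb] := zw_perm pe.
rewrite inE eq_sym; have [jl|jl] /= := eqVneq j (lo r).
  subst j; rewrite eqxx scale1r.
  have [ls|ls] := boolP (lo r \in s); last first.
    rewrite (negPf ls) in ha1; exists (t ^ wt r s); split; first exact: tX_gt0.
    by rewrite (eqP ha1) scale0r mulr0 addr0 -scalerAr.
  rewrite ls in ha1.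
  have [b' b0' hb'] : exists2 b : C, 0 < b &
      zw [:: lo r, hi r & rem (lo r) s] = b *: zw (hi r :: s).
    apply: zw_perm; rewrite (perm_trans pe) // perm_cons perm_sym.
    exact: perm_to_rem.
  exists (t ^ wt r s + t ^ (- wt1 r (lo r)) * a1 * b'); split.
    by rewrite addr_gt0 ?mulr_gt0 ?tX_gt0.
  by rewrite -scalerAr -scalerAl -scalerAr -!mv hb' !scalerA -scalerDl.
rewrite (negPf jl) scale0r mul0r add0r.
have -> : (t ^ (- wt1 r j) *: z u j) * (a1 *: zw (hi r :: rem (lo r) s)) =
    (a1 * t ^ (- wt1 r j) * b) *: zw [:: hi r, j & rem (lo r) s].
  by rewrite -scalerAr -scalerAl scalerA -mv hb scalerA.
exists (a1 * t ^ (- wt1 r j) * b); split=> //; case: ifP ha1 => _.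
  by move=> a0; rewrite !mulr_gt0 ?tX_gt0.
by move/eqP ->; rewrite !mul0r.
Qed.

(** Some E_r |> strictly raises the letters as long as one of them is not the
    last, and a power of the last coordinate has counit 1. *)
Lemma zw_neq0 s : zw s != 0.
Proof.
pose lv (s : word) := sumn [seq (l - val i)%N | i <- s].
move: {2}(lv s) (erefl (lv s)) => k.
elim: k s => [|k IH] s hk.
  have [c1 cM] := @counit_monoid_morphism C A.
  suff c0 : counit (zw s) = 1.
    apply/eqP => e; move: c0; rewrite e.
    have := @counit_linear C A (-1) 0 0; rewrite scaler0 addr0 /= mulN1r addNr => ->.
    by move/eqP; rewrite eq_sym oner_eq0.
  elim: s hk => [|j s IHs] //=; rewrite /lv /= => /eqP.
  rewrite addn_eq0 => /andP [lj /eqP /IHs e]; rewrite zw_cons cM e mulr1.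
  rewrite (SUq_counit hA) (_ : j = ord_max) ?eqxx //; apply: val_inj => /=.
  by have := ltn_ord j; move: lj; rewrite /= ; lia.
have /hasP [j js lj] : has (fun i : letter => i < l)%N s.
  apply/contraT => /hasPn h; move: hk; rewrite /lv.
  suff -> : [seq (l - val i)%N | i <- s] = nseq (size s) 0%N by rewrite sumn_nseq.
  apply: (@eq_from_nth _ 0%N); rewrite ?size_map ?size_nseq // => i hi_.
  rewrite (nth_map ord0) // nth_nseq hi_; apply/eqP; rewrite subn_eq0 leqNgt.
  by apply: h; apply: mem_nth.
pose r := Ordinal lj; have er : lo r = j by apply: val_inj.
have [a [ha e]] := lactE_zw r s; rewrite er js in ha.
apply/eqP => z0; move: e; rewrite z0 lact0 => /esym/eqP.
rewrite scaler_eq0 gt_eqF //= er; apply/negP; apply: IH.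
move: hk; rewrite /lv (perm_sumn (perm_map _ (perm_to_rem js))) /= /bump /=.
by lia.
Qed.

(** As q is not 1, weights are determined by the scalars through which the K_r
    act. *)
Lemma tX_inj (m n : int) : t ^ m = t ^ n -> m = n.
Proof.
have e k : t ^ k = (Num.sqrt q ^ k)%:C by rewrite fmorphXz.
rewrite !e => /complexI /ieexprIz; apply; first by rewrite sqrtr_gt0.
by rewrite -sqrtr1 eqr_sqrt ?ltW // lt_eqF.
Qed.

(** The weights give the differences of consecutive multiplicities, and the
    length their sum. *)
Lemma wt_size_inj (s v : word) : size s = size v ->
  (forall r, wt r s = wt r v) -> forall i, count_mem i s = count_mem i v.
Proof.
move=> sv W i.
pose d (j : letter) : int := (count_mem j s)%:Z - (count_mem j v)%:Z.
have dS r : d (hi r) = d (lo r) by have := W r; rewrite /wt /d; lia.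
have d0 (j : letter) : d j = d ord0.
  case: j => j; elim: j => [|j IHj] hj; first by congr d; apply: val_inj.
  have hj' : (j < l.+1)%N by lia.
  rewrite -(IHj hj'); have hjl : (j < l)%N by lia.
  have := dS (Ordinal hjl); congr (d _ = d _); exact: val_inj.
have : \sum_j d j = 0.
  rewrite sumrB -!(big_morph Posz PoszD (erefl _)) !sum_count sv; lia.
rewrite (eq_bigr (fun _ => d ord0)) // sumr_const card_ord.
by move/eqP; rewrite mulrn_eq0 /= -(d0 i) subr_eq0 => /eqP; case.
Qed.

(** Eigenvectors of the K_r |> with distinct systems of eigenvalues. *)
Lemma zw_free (T : eqType) (S : seq T) (wd : T -> word) n (c : T -> C) :
  uniq S -> (forall x, x \in S -> size (wd x) = n) ->
  (forall x y, x \in S -> y \in S ->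
     (forall i, count_mem i (wd x) = count_mem i (wd y)) -> x = y) ->
  \sum_(x <- S) c x *: zw (wd x) = 0 -> forall x, x \in S -> c x = 0.
Proof.
elim: S c => [|x0 S IH] c //= /andP [x0S uS] hn hinj h0.
(* Applying K_r |> minus its eigenvalue on the first monomial removes it. *)
have H r : \sum_(x <- S) (c x * (t ^ wt r (wd x) - t ^ wt r (wd x0))) *: zw (wd x) = 0.
  have := congr1 (lact P (K r)) h0; rewrite lact0 big_cons.
  have lsum (L : seq T) : lact P (K r) (\sum_(x <- L) c x *: zw (wd x)) =
      \sum_(x <- L) (c x * t ^ wt r (wd x)) *: zw (wd x).
    elim: L => [|y L IHL]; first by rewrite !big_nil lact0.
    by rewrite !big_cons lact_lin IHL lactK_zw scalerA.
  rewrite lact_lin lsum lactK_zw scalerA => h1.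
  move: h0; rewrite big_cons => /(congr1 (fun y => t ^ wt r (wd x0) *: y)).
  rewrite scaler0 scalerDr scalerA => h2.
  rewrite mulrC in h1; have /eqP := addrI _ (etrans h1 (esym h2)).
  rewrite -subr_eq0 => /eqP e; rewrite -[RHS]e scaler_sumr -sumrB; apply: eq_bigr => y _.
  by rewrite scalerA -scalerBl; congr (_ *: _); ring.
have cS x : x \in S -> c x = 0.
  move=> xS; have [//|cx] := eqVneq (c x) 0; case/negP: x0S.
  suff -> : x0 = x by [].
  apply: (hinj x0 x); rewrite ?inE ?eqxx ?xS ?orbT // => i.
  have W r : wt r (wd x0) = wt r (wd x).
    have /(_ x xS) : forall y, y \in S -> c y * (t ^ wt r (wd y) - t ^ wt r (wd x0)) = 0.
      apply: (IH _ uS _ _ (H r)) => [y yS|y y' yS yS'].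
        by apply: hn; rewrite inE yS orbT.
      by apply: hinj; rewrite inE ?yS ?yS' orbT.
    move/eqP; rewrite mulf_eq0 (negPf cx) subr_eq0 => /eqP.
    by move/tX_inj.
  by apply: wt_size_inj W i; rewrite !hn ?inE ?eqxx ?xS ?orbT.
move=> x; rewrite inE => /orP [/eqP ->|]; last exact: cS.
move: h0; rewrite big_cons big_seq big1 => [|y /cS ->]; last by rewrite scale0r.
by rewrite addr0 => /eqP; rewrite scaler_eq0 (negPf (zw_neq0 _)) orbF => /eqP.
Qed.

(** * The holomorphic connection *)

Lemma starD (a b : A) : star (a + b) = star a + star b.
Proof. by have := star_antilinear 1 a b; rewrite !scale1r conjC1 scale1r. Qed.

Lemma star0 : star (0 : A) = 0.
Proof. by apply: (@addrI _ (star 0)); rewrite -starD !addr0. Qed.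

Lemma starZ (c : C) (a : A) : star (c *: a) = c^*%R *: star a.
Proof. by rewrite -[c *: a]addr0 star_antilinear star0 addr0. Qed.

(** Tensors can only be tested on linear maps and star is antilinear, so the
    bilinear map is conjugated both at the source and, by tau, at the target. *)
Lemma comul_star_u (V : lmodType C) (tau : V -> V) (b : A -> A -> V) i j :
  (forall c v w, tau (c *: v + w) = c^*%R *: tau v + tau w) -> involutive tau ->
  is_bilin b ->
  \sum_(p <- comul (star (u i j))) b p.1 p.2 =
  \sum_k b (star (u i k)) (star (u k j)).
Proof.
move=> tl tK hb.
have tD v w : tau (v + w) = tau v + tau w.
  by have := tl 1 v w; rewrite !scale1r conjC1 scale1r.
have t0 : tau 0 = 0 by apply: (@addrI _ (tau 0)); rewrite -tD !addr0.
have tsum (T : Type) (s : seq T) (f : T -> V) :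
    tau (\sum_(x <- s) f x) = \sum_(x <- s) tau (f x).
  by elim/big_rec2: _ => [|x y w _ <-]; [exact: t0 | rewrite tD].
rewrite (tensor2_bilin hb (comul_star (u i j))) big_map /=.
apply: (can_inj tK); rewrite !tsum.
apply: (comul_u_bilin (b := fun x y => tau (b (star x) (star y)))).
split=> [y c x x'|x c y y'] /=.
  by rewrite star_antilinear hb.1 tl conjCK.
by rewrite star_antilinear hb.2 tl conjCK.
Qed.

Lemma is_bilin_sum (X Y Z : lmodType C) (T : Type) (s : seq T) (b : T -> X -> Y -> Z) :
  (forall w, is_bilin (b w)) -> is_bilin (fun x y => \sum_(w <- s) b w x y).
Proof.
move=> hb; split=> [y c x x'|x c y y'] /=;
  by rewrite scaler_sumr -big_split /=; apply: eq_bigr => w _; rewrite (hb w).1 || rewrite (hb w).2.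
Qed.

Lemma is_bilin_mul (Z : lmodType C) (b : A -> A -> Z) a a' :
  is_bilin b -> is_bilin (fun x y => b (x * a) (y * a')).
Proof.
move=> hb; split=> [y c x x'|x c y y'] /=.
  by rewrite mulrDl -scalerAl hb.1.
by rewrite mulrDl -scalerAl hb.2.
Qed.

Lemma comul_star_uM (V : lmodType C) (tau : V -> V) (b : A -> A -> V) i j a :
  (forall c v w, tau (c *: v + w) = c^*%R *: tau v + tau w) -> involutive tau ->
  is_bilin b ->
  \sum_(p <- comul (star (u i j) * a)) b p.1 p.2 =
  \sum_k \sum_(r <- comul a) b (star (u i k) * r.1) (star (u k j) * r.2).
Proof.
move=> tl tK hb; rewrite comulM_bilin //.
apply: (comul_star_u (b := fun x y => \sum_(r <- comul a) b (x * r.1) (y * r.2)) i j tl tK).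
by apply: is_bilin_sum => r; apply: is_bilin_mul.
Qed.

Lemma u_antipode i j :
  \sum_m u i m * antipode (u m j) = (i == j)%:R%:A.
Proof.
have := antipoder (u i j); rewrite (SUq_counit hA) => <-.
rewrite (comul_u_bilin (b := fun x y => x * antipode y)) //.
split=> [y c x x'|x c y y'] /=; first by rewrite mulrDl -scalerAl.
by rewrite antipode_linear mulrDr -scalerAr.
Qed.

Lemma P_sum h (T : Type) (s : seq T) (f : T -> A) :
  P h (\sum_(x <- s) f x) = \sum_(x <- s) P h (f x).
Proof. exact: linear_sum. Qed.

Lemma P_delta h i j : P h ((i == j :> letter)%:R%:A) = (i == j)%:R * counit h.
Proof. by rewrite linearZ /= (pairing1r hpair). Qed.

Lemma PK'antipode r j : P (K' r) (antipode (u ord_max j)) =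
  (j == ord_max)%:R * t ^ wt1 r ord_max.
Proof.
have := congr1 (P (K' r)) (u_antipode ord_max j).
rewrite P_sum P_delta (bigD1 ord_max) //= big1 => [|m mi]; last first.
  by rewrite grouplikeK' PK'u eq_sym (negPf mi) !mul0r.
rewrite addr0 grouplikeK' PK'u eqxx mul1r.
have -> : counit (K' r) = 1.
  have [h1 _] := Uq_KV hrel r; have [c1 cM] := @counit_monoid_morphism C U.
  by have := cM (K r) (K' r); rewrite h1 c1 (Uq_counitK hU) mul1r.
rewrite mulr1 eq_sym => e; apply: (mulfI (tX_neq0 (- wt1 r ord_max))).
by rewrite e mulrCA -tXD addNr expr0z mulr1.
Qed.

Lemma PFantipode r j : P (F r) (antipode (u ord_max j)) = 0.
Proof.
have ml : (ord_max == lo r) = false.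
  by apply/negP => /eqP /(congr1 val) /= e; have := ltn_ord r; rewrite -e ltnn.
have := congr1 (P (F r)) (u_antipode ord_max j).
rewrite P_sum P_delta counitF mulr0 (bigD1 ord_max) //= big1 => [|m mi]; last first.
  by rewrite skewF PFu PK'u ml [ord_max == m]eq_sym (negPf mi) !mul0r addr0.
rewrite addr0 skewF PFu PK'u ml eqxx mul0r add0r mul1r => /eqP.
by rewrite mulf_eq0 (negPf (tX_neq0 _)) => /eqP.
Qed.

Let zl := star (u ord_max ord_max).

(** The products F_l ... F_i are of this kind, which is why Psi_N only
    contributes a scalar to the connection. *)
Definition zstar_scalar (h : U) := exists2 kap : C, kap != 0 &
  forall b, P h (zl * b) = kap * P h b.

Lemma zstar_scalar1 : zstar_scalar 1.
Proof.
exists 1 => [|b]; first exact: oner_neq0.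
have [c1 cM] := @counit_monoid_morphism C A.
rewrite !(pairing1l hpair) cM; congr (_ * _).
have := congr1 counit (u_antipode ord_max ord_max).
have cl := @counit_linear C A.
pose cL := GRing.isLinear.Build C A C^o *%R counit cl.
pose cc : {scalar A} := HB.pack (counit : A -> C^o) cL.
rewrite -[counit]/(cc : A -> C) linear_sum (bigD1 ord_max) //= big1 ?addr0; last first.
  by move=> m mi; rewrite cM (SUq_counit hA) eq_sym (negPf mi) mul0r.
rewrite cM (SUq_counit hA) eqxx mul1r scale1r c1 => <-.
by rewrite /zl -(SUq_antipode hA).
Qed.

(** F_r |> kills the conjugate of z_(l+1), on which the inverse of K_r acts by a
    scalar. *)
Lemma zstar_scalarF h r : zstar_scalar h -> zstar_scalar (h * F r).
Proof.
move=> [kap k0 hk]; exists (kap * t ^ wt1 r ord_max).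
  by rewrite mulf_neq0 ?tX_neq0.
move=> b; rewrite !(pairing_mull hpair).
rewrite /zl (comul_star_uM (tau := (fun x : C^o => x^*%R : C^o)) _ _ _ _ _ (is_bilin_pair P h (F r))); last first.
- exact: conjCK.
- by move=> c v w; rewrite rmorphD rmorphM.
rewrite (bigD1 ord_max) //= [X in _ + X]big1 ?addr0 => [|k km]; last first.
  apply: big1 => p _; rewrite skewF -!(SUq_antipode hA) PFantipode PK'antipode.
  by rewrite (negPf km) !mul0r addr0 mulr0.
rewrite mulr_sumr; apply: eq_bigr => p _.
rewrite -/zl hk skewF /zl -!(SUq_antipode hA) PFantipode PK'antipode eqxx mul0r add0r mul1r.
by rewrite mulrACA.
Qed.

Lemma zstar_scalar_Fdown i : zstar_scalar (Fdown F i).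
Proof.
suff gen (s : seq 'I_l) (Q : pred 'I_l) h : zstar_scalar h ->
    zstar_scalar (h * \prod_(k <- s | Q k) F k).
  by rewrite /Fdown -[X in zstar_scalar X]mul1r; apply/gen/zstar_scalar1.
elim: s h => [|k s IH] h hh.
  by rewrite big_nil mulr1.
by rewrite big_cons; case: ifP => _; [rewrite mulrA; apply/IH/zstar_scalarF | apply: IH].
Qed.

(** Unitarity of u: the sum over j of z_j (u^k_j)^* is 1 for the last row and 0
    for the others. *)
Lemma sum_z_zstar h b :
  \sum_j z u j * ract P (star (z u j) * b) h =
  \sum_(p <- comul b) P h (zl * p.1) *: p.2.
Proof.
transitivity (\sum_j \sum_k \sum_(r <- comul b)
   P h (star (u ord_max k) * r.1) *: (u ord_max j * antipode (u j k) * r.2)).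
  apply: eq_bigr => j _; rewrite /Defs.ract /z.
  rewrite (comul_star_uM (tau := star) _ _ _ (@star_antilinear _ _) (@starK _ _) (is_bilin_act P h)).
  rewrite mulr_sumr; apply: eq_bigr => k _; rewrite mulr_sumr; apply: eq_bigr => r _.
  by rewrite -scalerAr mulrA (SUq_antipode hA).
rewrite exchange_big (bigD1 ord_max) //= [X in _ + X]big1 ?addr0 => [|k km]; last first.
  rewrite exchange_big; apply: big1 => r _.
  by rewrite -scaler_sumr -mulr_suml u_antipode eq_sym (negPf km) scale0r mul0r scaler0.
rewrite exchange_big; apply: eq_bigr => r _.
by rewrite -scaler_sumr -mulr_suml u_antipode eqxx scale1r mul1r.
Qed.

Lemma sum_zw_zstar h kap n b : (forall b, P h (zl * b) = kap * P h b) ->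
  \sum_(s <- words n) zw s * ract P (star (zw s) * b) h = kap ^+ n *: ract P b h.
Proof.
move=> hk; elim: n b => [|n IH] b.
  have s1 : star (1 : A) = 1.
    by rewrite -[star 1]mulr1 -{2}[1](starK 1) -starM mulr1 starK.
  by rewrite sum_words0 /zw /= s1 !mul1r scale1r.
rewrite sum_wordsS.
transitivity (\sum_i z u i * (kap ^+ n *: ract P (star (z u i) * b) h)).
  apply: eq_bigr => i _; rewrite -IH mulr_sumr; apply: eq_bigr => s _.
  by rewrite zw_cons starM !mulrA.
transitivity (kap ^+ n *: \sum_i z u i * ract P (star (z u i) * b) h).
  by rewrite scaler_sumr; apply: eq_bigr => i _; rewrite scalerAr.
rewrite sum_z_zstar exprSr -scalerA; congr (_ *: _).
rewrite /Defs.ract scaler_sumr; apply: eq_bigr => p _.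
by rewrite hk scalerA.
Qed.

(** * Gaussian multinomials count words by inversions *)

Fixpoint winv (s : word) : nat :=
  if s is x :: s' then (count (fun y : letter => y < x)%N s' + winv s')%N else 0%N.

(** Each adjacent exchange in zw s costs a factor q and changes the number of
    inversions by one. *)
Lemma zw_winv s v : perm_eq s v -> q%:C ^+ winv s *: zw s = q%:C ^+ winv v *: zw v.
Proof.
suff h : forall s v, perm_eq s v -> perm_eq s v /\
    q%:C ^+ winv s *: zw s = q%:C ^+ winv v *: zw v by case/h.
apply: perm_eq_ind => //.
- by move=> a b c [p1 e1] [p2 e2]; split; [exact: perm_trans p1 p2 | rewrite e1].
- move=> x a b [p1 e1]; split; first by rewrite perm_cons.
  rewrite !zw_cons /= (seq.permP p1) !exprD -!scalerA; congr (_ *: _).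
  by rewrite !scalerAr e1.
- move=> x y a; split; first by rewrite -cat1s -[y :: a]cat1s perm_catCA.
  wlog xy : x y / (x <= y)%N.
    by move=> h; case: (leqP x y) => [/h //|/ltnW /h].
  rewrite !zw_cons !mulrA /z /=; move: xy; rewrite leq_eqVlt => /orP [/eqP/val_inj -> //|xy].
  rewrite (SUq_row hsu ord_max xy) -scalerAl scalerA -exprSr; congr (_ ^+ _ *: _).
  rewrite xy ltnNge ltnW //=; lia.
Qed.

Definition zword (J : letter -> nat) : word :=
  flatten [seq nseq (J j) j | j <- enum 'I_l.+1].

Lemma zmonE (J : letter -> nat) : \prod_j z u j ^+ J j = zw (zword J).
Proof.
transitivity (\prod_(j <- enum 'I_l.+1) z u j ^+ J j); first by
  rewrite enumT [index_enum _]unlock.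
rewrite /zword; elim: (enum _) => [|j s IH]; first by rewrite big_nil.
rewrite big_cons /= zw_cat IH; congr (_ * _).
by elim: (J j) => [|n IHn] //=; rewrite exprS zw_cons IHn.
Qed.

Lemma count_zword J i : count_mem i (zword J) = J i.
Proof.
rewrite /zword count_flatten -map_comp sumnE big_map big_enum /=.
rewrite (bigD1 i) //= count_nseq /= eqxx mul1n big1 ?addn0 // => j /negPf ji.
by rewrite /= count_nseq /= ji.
Qed.

Lemma winv_zword J : winv (zword J) = 0%N.
Proof.
have : sorted (fun x y : letter => x <= y)%N (enum 'I_l.+1).
  by have := iota_sorted 0 l.+1; rewrite -val_enum_ord sorted_map.
rewrite /zword; elim: (enum _) => [|j s IH] //= js.
have tr : transitive (fun x y : letter => x <= y)%N by move=> a b c; apply: leq_trans.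
have {}IH := IH (path_sorted js).
have js' := order_path_min tr js.
elim: (J j) => [|n IHn] //=; rewrite IHn addn0 count_cat count_nseq /= ltnn mul0n.
apply/eqP; rewrite -leqn0 leqNgt -has_count; apply/hasPn => x.
case/flattenP => v /mapP [k ks ->]; rewrite mem_nseq => /andP [_ /eqP ->].
by rewrite -leqNgt; exact: (allP js').
Qed.

Lemma zw_normal s (J : letter -> nat) : (forall i, count_mem i s = J i) ->
  zw s = q%:C ^- winv s *: zw (zword J).
Proof.
move=> h; have pe : perm_eq s (zword J).
  by apply: count_perm => i; rewrite h count_zword.
have := zw_winv pe; rewrite winv_zword expr0 scale1r => <-.
by rewrite scalerA mulVf ?scale1r // expf_neq0 // gt_eqF // qC_gt0.
Qed.

Definition decr (J : letter -> nat) (i : letter) : letter -> nat :=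
  fun k => (J k - (k == i))%N.

Lemma decrE J i k : (0 < J i)%N -> J k = (decr J i k + (k == i))%N.
Proof. by rewrite /decr; case: eqP => [->|_] h /=; lia. Qed.

Lemma sum_decr J i : (0 < J i)%N -> (\sum_k J k = (\sum_k decr J i k).+1)%N.
Proof.
move=> h; rewrite (eq_bigr _ (fun k _ => decrE k h)) big_split /=.
have -> : (\sum_k (k == i) = 1)%N.
  by rewrite (bigD1 i) //= eqxx big1 // => k /negPf ->.
by rewrite addn1.
Qed.

Definition cross (J : letter -> nat) : nat :=
  (\sum_(r < l.+1) \sum_(s < l.+1 | r < s) J r * J s)%N.

Lemma cross_decr J i : (0 < J i)%N ->
  cross J = (cross (decr J i) + (\sum_k J k - J i))%N.
Proof.
move=> h; pose D := decr J i.
have e1 : (\sum_k J k - J i)%N =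
    (\sum_(r < l.+1) ((r < i) * D r + (i < r) * D r))%N.
  rewrite (bigD1 i) //= addKn [RHS](bigD1 i) //= ltnn add0n.
  apply: eq_bigr => r ri; rewrite (decrE r h) (negPf ri) addn0 -mulnDl.
  suff -> : ((r < i) + (i < r) = 1)%N by rewrite mul1n.
  by rewrite -val_eqE /= in ri; lia.
rewrite e1 /cross -!big_split /=.
transitivity (\sum_(r < l.+1) ((\sum_(s < l.+1 | r < s) D r * D s) +
    ((r < i) * D r + (r == i) * (\sum_(s < l.+1 | i < s) D s))))%N.
  apply: eq_bigr => r _.
  rewrite (eq_bigr (fun s : letter => D r * D s + ((s == i) * D r + (r == i) * D s)))%N; last first.
    move=> s rs; rewrite (decrE r h) (decrE s h) -/D.
    have : ~~ ((r == i) && (s == i)).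
      by apply/negP => /andP [/eqP e1' /eqP e2']; move: rs; rewrite e1' e2' ltnn.
    by case: (r == i); case: (s == i) => //= _; lia.
  rewrite !big_split /= -big_distrr /=; congr (_ + (_ + _))%N.
    have [ri|ri] := boolP (r < i)%N.
      rewrite (bigD1 i) //= eqxx big1 ?addn0 // => s /andP [_ /negPf ->].
      by rewrite mul0n.
    rewrite big1 ?mul0n // => s rs; case: eqP => [e|_]; last by rewrite mul0n.
    by rewrite -e rs in ri.
  by rewrite -big_distrr /=; case: eqP => [->|_]; rewrite ?mul0n.
rewrite !big_split /=; congr (_ + (_ + _))%N.
rewrite (bigD1 i) //= eqxx mul1n [X in (_ + X)%N]big1 ?addn0 => [|r /negPf ->]; last by rewrite mul0n.
rewrite [LHS]big_mkcond; apply: eq_bigr => r _.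
by case: ifP => _; rewrite ?mul1n ?mul0n.
Qed.

Lemma qnum_gt0 n : (0 < n)%N -> 0 < qnum q n.
Proof.
move=> n0; have h m : (0 < m)%N -> q ^+ m - q ^- m < 0.
  move=> m0; have q1 : q ^+ m < 1 by rewrite exprn_ilt1 ?ltW // -lt0n.
  by rewrite subr_lt0 (lt_trans q1) // invf_gt1 ?exprn_gt0.
by rewrite /qnum nmulr_lgt0 ?invr_lt0 ?(h 1%N) // h.
Qed.

Lemma qfact_gt0 n : 0 < qfact q n.
Proof. by apply: prodr_gt0 => i _; exact: qnum_gt0. Qed.

Lemma qmult_gt0 (J : letter -> nat) : 0 < qmultinomial q J.
Proof.
rewrite /qmultinomial divr_gt0 ?mulr_gt0 ?qfact_gt0 ?invr_gt0 ?exprn_gt0 //.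
by apply: prodr_gt0 => i _; exact: qfact_gt0.
Qed.

Lemma qfactS n : qfact q n.+1 = qfact q n * qnum q n.+1.
Proof. by rewrite /qfact big_ord_recr. Qed.

Lemma qmult_decr J i : (0 < J i)%N -> qmultinomial q (decr J i) =
  q ^+ (\sum_k J k - J i) * qnum q (J i) / qnum q (\sum_k J k)%N * qmultinomial q J.
Proof.
move=> h; pose p := \prod_(k | k != i) qfact q (J k).
have e : J i = (decr J i i).+1 by rewrite {1}(decrE i h) eqxx addn1.
have pJ : \prod_k qfact q (J k) = qfact q (decr J i i) * qnum q (J i) * p.
  by rewrite (bigD1 i) //= e qfactS.
have pD : \prod_k qfact q (decr J i k) = qfact q (decr J i i) * p.
  rewrite (bigD1 i) //=; congr (_ * _).
  by apply: eq_bigr => k /negPf ki; rewrite [J k in RHS](decrE k h) ki addn0.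
rewrite /qmultinomial -!/(cross _) pJ pD (cross_decr h) (sum_decr h) qfactS exprD.
have p0 : 0 < p by apply: prodr_gt0 => k _; exact: qfact_gt0.
field; rewrite !(gt_eqF (qfact_gt0 _)) (gt_eqF p0) !expf_neq0 ?gt_eqF ?qnum_gt0 //.
Qed.

Definition below (J : letter -> nat) (i : letter) : nat :=
  (\sum_(j < l.+1 | j < i) J j)%N.

(** Multiplied by q - q^-1, the i-th term is q^N times the difference of the
    values of q^(-2 a) at two consecutive partial sums a of J, with N the total
    of J. *)
Lemma qnum_telescope (J : letter -> nat) :
  \sum_i q ^- (below J i) ^+ 2 * (q ^+ (\sum_k J k - J i) * qnum q (J i)) =
  qnum q (\sum_k J k)%N.
Proof.
pose J' k := J (inord k); pose N := (\sum_k J k)%N.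
pose a m := (\sum_(k < m) J' k)%N.
have aN : a l.+1 = N by apply: eq_bigr => k _; rewrite /J' inord_val.
have qn0 : q != 0 by rewrite gt_eqF.
have qd : q * q - 1 != 0.
  by rewrite subr_eq0 lt_eqF // -expr2 exprn_ilt1 // ltW.
have ab (i : letter) : below J i = a i.
  rewrite /below /a (big_ord_widen l.+1) 1?ltnW //.
  by apply: eq_bigr => k _; rewrite /J' inord_val.
have tele m : (m <= l.+1)%N ->
    \sum_(i < m) q ^- (a i) ^+ 2 * (q ^+ (N - J' i) * qnum q (J' i)) =
    q ^+ N * (1 - q ^- (a m) ^+ 2) / (q - q^-1).
  elim: m => [|m IH] hm.
    by rewrite big_ord0 /a big_ord0 expr0 invr1 expr1n subrr mulr0 mul0r.
  rewrite big_ord_recr /= IH 1?ltnW // /a big_ord_recr /= -/(a m) exprD.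
  have JN : (J' m <= N)%N.
    by rewrite /N (bigD1 (inord m)) //= leq_addr.
  have -> : q ^+ N = q ^+ (N - J' m) * q ^+ J' m by rewrite -exprD subnK.
  by rewrite /qnum; field; rewrite qn0 qd !expf_neq0.
transitivity (\sum_(i < l.+1) q ^- (a i) ^+ 2 * (q ^+ (N - J' i) * qnum q (J' i))).
  by apply: eq_bigr => i _; rewrite ab /J' inord_val.
by rewrite tele // aN /qnum; field; rewrite qd qn0 !expf_neq0.
Qed.

(** The q-Pascal rule, the same recursion as the one obtained by removing the
    first letter of a word. *)
Lemma qmult_pascal (J : letter -> nat) : (0 < \sum_k J k)%N ->
  qmultinomial q J =
  \sum_(i | (0 < J i)%N) q ^- (below J i) ^+ 2 * qmultinomial q (decr J i).
Proof.
move=> J0.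
rewrite [RHS](eq_bigr (fun i => q ^- (below J i) ^+ 2 *
   (q ^+ (\sum_k J k - J i) * qnum q (J i)) * (qmultinomial q J / qnum q (\sum_k J k)%N))).
  2: by move=> i Ji; rewrite qmult_decr //; ring.
rewrite -mulr_suml big_mkcond /=.
have -> : \sum_i (if (0 < J i)%N then q ^- (below J i) ^+ 2 *
   (q ^+ (\sum_k J k - J i) * qnum q (J i)) else 0) = qnum q (\sum_k J k)%N.
  rewrite -qnum_telescope; apply: eq_bigr => i _; case: posnP => // ->.
  by rewrite /qnum expr0 invr1 subrr mul0r !mulr0.
by rewrite mulrCA mulfV ?mulr1 // gt_eqF // qnum_gt0.
Qed.

Definition wordsum n (J : letter -> nat) : R :=
  \sum_(s <- words n | [forall i, count_mem i s == J i]) q ^- (winv s) ^+ 2.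

Lemma count_below (J : letter -> nat) (i : letter) (s : word) :
  (forall k : letter, (k < i)%N -> count_mem k s = J k) ->
  count (fun y : letter => y < i)%N s = below J i.
Proof.
move=> h; rewrite /below -(eq_bigr _ h).
elim: s {h} => [|x s IH] /=; first by rewrite big1.
rewrite big_split /= -IH; congr (_ + _)%N.
have [xi|xi] := boolP (x < i)%N.
  rewrite (bigD1 x) //= eqxx big1 // => k /andP [_ kx].
  by rewrite eq_sym (negPf kx).
by rewrite big1 // => k ki; case: eqP => // e; rewrite e ki in xi.
Qed.

Lemma wordsumE n (J : letter -> nat) :
  (\sum_k J k = n)%N -> wordsum n J = qmultinomial q J.
Proof.
elim: n J => [|n IH] J hJ.
  have J0 i : J i = 0%N.
    by apply/eqP; rewrite -leqn0 -hJ (bigD1 i) //= leq_addr.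
  rewrite /wordsum big_cons big_nil /=.
  have -> : [forall i, 0%N == J i] by apply/forallP => i; rewrite J0.
  rewrite /qmultinomial hJ big1 => [|r _]; last by rewrite big1 // => s _; rewrite !J0.
  rewrite big1 => [|r _]; last by rewrite J0 /qfact big_ord0.
  by rewrite /qfact big_ord0 expr0 invr1 expr1n addr0 !mulr1 ?invr1.
rewrite qmult_pascal ?hJ // /wordsum big_mkcond sum_wordsS.
rewrite [RHS]big_mkcond; apply: eq_bigr => i _.
have ctE (s : word) : [forall k, count_mem k (i :: s) == J k] =
    (0 < J i)%N && [forall k, count_mem k s == decr J i k].
  apply/forallP/andP => [h|[J0 /forallP h] k].
    have h0 : (0 < J i)%N by rewrite -(eqP (h i)) /= eqxx.
    split=> //; apply/forallP => k; rewrite /decr -(eqP (h k)) /= [i == k]eq_sym.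
    by rewrite addKn.
  by rewrite /= (eqP (h k)) (decrE k J0) addnC [i == k]eq_sym.
under eq_bigr do rewrite ctE.
case: ifP => J0 /=; last by rewrite big1.
rewrite -IH; last by apply/eqP; rewrite -eqSS -sum_decr // hJ.
rewrite /wordsum mulr_sumr [RHS]big_mkcond; apply: eq_bigr => s _.
case: ifP => // /forallP h; rewrite /= (@count_below J) => [|k ki].
  by rewrite exprD invfM exprMn.
rewrite (eqP (h k)) /decr; case: eqP => [e|_]; last by rewrite subn0.
by rewrite e ltnn in ki.
Qed.

Lemma prod_zword_star (b : A) h s (J : letter -> nat) :
  (forall i, count_mem i s = J i) ->
  zw s * ract P (star (zw s) * b) h = (q ^- (winv s) ^+ 2)%:C *:
    (zw (zword J) * ract P (star (zw (zword J)) * b) h).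
Proof.
move=> hs; rewrite (zw_normal hs) starZ -!scalerAl ractZ -scalerAr scalerA.
congr (_ *: _); rewrite conj_gt0 ?invr_gt0 ?exprn_gt0 ?qC_gt0 //.
by rewrite -rmorphXn /= -fmorphV /= -rmorphM -expr2.
Qed.

(** Collects the words with the same letters: each is the ordered monomial up to
    a power of q, and the powers add up to the q-multinomial coefficient. *)
Lemma sum_content n (b : A) h :
  \sum_(s <- words n) zw s * ract P (star (zw s) * b) h =
  \sum_(J : {ffun letter -> 'I_n.+1} | (\sum_j J j == n)%N)
     (qmultinomial q (val \o J))%:C *:
       (zw (zword (val \o J)) * ract P (star (zw (zword (val \o J))) * b) h).
Proof.
pose g J := zw (zword J) * ract P (star (zw (zword J)) * b) h.
pose ct (s : word) : {ffun letter -> 'I_n.+1} := [ffun j => inord (count_mem j s)].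
have ctE s j : size s = n -> ct s j = count_mem j s :> nat.
  by move=> hs; rewrite ffunE inordK // ltnS -hs count_size.
transitivity (\sum_(s <- words n) \sum_(J : {ffun letter -> 'I_n.+1} | (\sum_j J j == n)%N && (J == ct s))
    (q ^- (winv s) ^+ 2)%:C *: g (val \o J)).
  apply: eq_words => s hs; rewrite (big_pred1 (ct s)) => [|J].
    by apply: prod_zword_star => i; rewrite /= ctE.
  rewrite andb_idl // => /eqP ->; apply/eqP; rewrite -[RHS]hs -sum_count.
  by apply: eq_bigr => j _; rewrite ctE.
rewrite (exchange_big_dep (fun J : {ffun letter -> 'I_n.+1} => (\sum_j J j == n)%N)) /=; last first.
  by move=> s J _ /andP [].
apply: eq_bigr => J /eqP hJ; rewrite -(wordsumE (n := n)) //.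
rewrite /wordsum rmorph_sum -scaler_suml; congr (_ *: _).
rewrite big_seq_cond [RHS]big_seq_cond; apply: eq_bigl => s.
rewrite mem_words; case: eqP => //= hs; rewrite hJ eqxx /=.
apply/eqP/forallP => [->|h']; first by move=> i; rewrite /= ctE.
by apply/ffunP => i; apply: val_inj; rewrite /= ctE // (eqP (h' i)).
Qed.

(** * Holomorphic sections as lowest weight vectors *)

(** For N >= 0 the scalar is what remains of the conjugate coordinates once
    F_l ... F_i has been moved past them. *)
Lemma nabla_scaled (N : int) : exists2 kap : 'I_l -> C, forall i, kap i != 0 &
  forall xi, nabla q F u P N xi = \row_i (kap i *: ract P xi (Fdown F i)).
Proof.
case: N => n /=; last first.
  exists (fun _ => - (Num.sqrt q ^ (- Negz n))%:C) => [i|xi].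
    rewrite oppr_eq0 fmorphXz.
    exact: tX_neq0.
  by apply/rowP => i; rewrite !mxE scalerN scaleNr.
pose kk i := s2val (cid2 (zstar_scalar_Fdown i)).
have kk0 i : kk i != 0 := s2valP (cid2 (zstar_scalar_Fdown i)).
have kkE i := s2valP' (cid2 (zstar_scalar_Fdown i)).
exists (fun i => - ((q ^- n)%:C * kk i ^+ n)) => [i|xi].
  rewrite oppr_eq0 mulf_neq0 ?expf_neq0 //.
  by rewrite gt_eqF // ltcR invr_gt0 exprn_gt0.
apply/rowP => i; rewrite !mxE scaleNr -scalerA -scalerN; congr (_ *: _).
rewrite -(sum_zw_zstar (h := Fdown F i)) // sum_content -sumrN.
apply: eq_bigr => J _; rewrite /psi /dbar mxE zmonE starZ starK.
rewrite -!scalerAl ractZ -scalerN -scalerAr scalerA mulrN scalerN.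
congr (- (_ *: _)).
have m0 := qmult_gt0 (val \o J).
rewrite conj_gt0 ?ltcR ?sqrtr_gt0 // -rmorphM -expr2 sqr_sqrtr //.
exact: ltW.
Qed.

Lemma Fdown_killed xi : (0 < l)%N -> (forall i, ract P xi (Fdown F i) = 0) ->
  (forall r : 'I_l, (r.+1 < l)%N -> ract P xi (F r) = 0) ->
  forall r, ract P xi (F r) = 0.
Proof.
move=> l0 h1 h2 r; have [|rl] := ltnP r.+1 l; first exact: h2.
rewrite -[RHS](h1 r); congr (ract P xi _).
rewrite /Fdown (eq_bigl (fun k => k == r)) => [|k]; last first.
  by rewrite -val_eqE /= eqn_leq; have := ltn_ord k; case: (leqP r k) => //=; lia.
by rewrite -big_filter filter_pred1_uniq ?big_seq1 ?rev_uniq ?enum_uniq ?mem_rev ?mem_enum.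
Qed.

Lemma killed_Fdown xi : (forall r, ract P xi (F r) = 0) ->
  forall i, ract P xi (Fdown F i) = 0.
Proof.
move=> h i; rewrite /Fdown -big_filter.
have : i \in [seq k : 'I_l <- rev (enum 'I_l) | (i <= k)%N].
  by rewrite mem_filter leqnn mem_rev mem_enum.
case: (filter _ _) => [//|k s] _.
by rewrite big_cons (ractM hpair) h ract0.
Qed.

Lemma nabla_eq0 (N : int) xi : (0 < l)%N ->
  (forall r : 'I_l, (r.+1 < l)%N -> ract P xi (F r) = 0) ->
  nabla q F u P N xi = 0 <-> forall r, ract P xi (F r) = 0.
Proof.
move=> l0 h; have [kap kap0 ->] := nabla_scaled N; split.
  move=> /rowP e; apply: Fdown_killed => // i; have := e i; rewrite !mxE.
  by move=> /eqP; rewrite scaler_eq0 (negPf (kap0 i)) => /eqP.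
by move=> /killed_Fdown h'; apply/rowP => i; rewrite !mxE h' scaler0.
Qed.

(** * Lifting lowest weight vectors to tensor powers *)

Definition Kprod : U := \prod_(i < l) K i ^+ i.+1.

(** Lowest weight elements of A, of weight n times the last fundamental weight.
    The weight is prescribed on K_r for r < l and on the product of the powers of
    the K_r, as in the definition of the line bundles. *)
Definition lowest_elt (n : int) (xi : A) : Prop :=
  [/\ forall r, ract P xi (F r) = 0,
      forall r : 'I_l, (r.+1 < l)%N -> ract P xi (K r) = xi &
      ract P xi Kprod = t ^ (n * l%:Z) *: xi].

Definition fund_wt (n : int) (r : 'I_l) : int := if r.+1 == l then n else 0.

Definition has_wt n (m : nat) (f : word -> C) : Prop :=
  forall s, size s = m -> f s != 0 -> forall r, wt r s = fund_wt n r.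

Definition kprod (s : word) : C := \prod_(i < l) (t ^ wt i s) ^+ i.+1.

Lemma actKprod f s : act Kprod f s = kprod s * f s.
Proof.
have actX h (kap : word -> C) : (forall f s, act h f s = kap s * f s) ->
    forall m f s, act (h ^+ m) f s = kap s ^+ m * f s.
  move=> hk; elim=> [|m IH] g v; first by rewrite act1 mul1r.
  by rewrite exprSr actM hk IH exprS mulrA.
rewrite /Kprod /kprod; elim: (index_enum _) f => [|i L IH] f.
  by rewrite !big_nil act1 mul1r.
rewrite !big_cons actM IH (actX _ _ (fun f s => @actK i f s)).
by rewrite mulrA; congr (_ * _); rewrite mulrC.
Qed.

Lemma kprod_gt0 s : 0 < kprod s.
Proof. by apply: prodr_gt0 => i _; rewrite exprn_gt0 ?tX_gt0. Qed.

(** The powers of t are all distinct, so K_l acts by t^n when its l-th power acts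
    by t^(n l). *)
Lemma kprod_last s n : (0 < l)%N -> (forall r : 'I_l, (r.+1 < l)%N -> wt r s = 0) ->
  kprod s = t ^ (n * l%:Z) <-> forall r, wt r s = fund_wt n r.
Proof.
move=> l0 h; have l1 : (l.-1 < l)%N by rewrite prednK.
pose last := Ordinal l1.
have lst (r : 'I_l) : (r.+1 == l) = (r == last).
  by rewrite -val_eqE /=; lia.
have notlast (r : 'I_l) : r != last -> (r.+1 < l)%N.
  by rewrite -val_eqE /=; have := ltn_ord r; lia.
have -> : kprod s = t ^ (wt last s * l%:Z).
  rewrite /kprod (bigD1 last) //= big1 => [|r /notlast /h ->]; last by rewrite expr1n.
  by rewrite mulr1 prednK // -exprz_exp.
split=> [/tX_inj e r|e]; last by rewrite e /fund_wt lst eqxx.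
rewrite /fund_wt lst; case: eqP => [->|/eqP /notlast /h //].
by apply: (@mulIf _ l%:Z) e; case: (l) l0.
Qed.

Section Lift.
Variables (Js : seq word) (ws : nat -> word -> C).
Let J p := nth [::] Js p.
Let Ph (vs : nat -> word -> C) := \sum_(p <- iota 0 (size Js)) phi (J p) (vs p).
Hypothesis ortho : forall vs, Ph vs = 0 ->
  \sum_(p <- iota 0 (size Js)) ip (size (J p)) (ws p) (vs p) = 0.

(** The difference of the two words, suitably weighted, is a relation. *)
Lemma lift_qsym p : (p < size Js)%N -> qsym (J p) (ws p).
Proof.
move=> pJ s1 s2 i j J1 c J2 eJ h1 h2 ij.
pose d (s v : word) : C := (v == s)%:R.
pose w1 := s1 ++ [:: i, j & s2]; pose w2 := s1 ++ [:: j, i & s2].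
have sz1 : size w1 = size (J p) by rewrite eJ !size_cat h1 /= h2.
have sz2 : size w2 = size (J p) by rewrite eJ !size_cat h1 /= h2.
have phid w : size w = size (J p) -> phi (J p) (d w) = mon w (J p).
  move=> hw; rewrite /phi (sum_words_delta hw) /d ?eqxx ?scale1r //.
  by move=> v _ /negPf ->; rewrite scale0r.
pose vs (p' : nat) s := if p' == p then - q%:C * d w2 s + d w1 s else 0.
have iop : p \in iota 0 (size Js) by rewrite mem_iota.
have phi0 J0 : phi J0 (fun _ => 0) = 0.
  by rewrite /phi big1 // => s _; rewrite scale0r.
have /ortho : Ph vs = 0.
  rewrite /Ph (bigD1_seq p) ?iota_uniq //= big1 => [|p' /negPf pp'].
    rewrite addr0 /vs eqxx phi_lin !phid // /w1 /w2 eJ !mon_cat //=.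
    rewrite !mulrA -!(mulrA _ (u _ c) (u _ c)) (SUq_col hsu c ij).
    by rewrite -scalerAr -scalerAl scaleNr addNr.
  by rewrite /vs pp' phi0.
rewrite (bigD1_seq p) ?iota_uniq //= big1 => [|p' /negPf pp']; last first.
  by rewrite /vs pp' /ip big1 // => s _; rewrite conjC0 mulr0.
rewrite addr0 /vs eqxx /ip.
under eq_bigr do rewrite rmorphD rmorphM rmorphN /= mulrDr !conjC_nat (conj_gt0 qC_gt0).
rewrite big_split /= (sum_words_delta sz2) => [|v _ /negPf vw]; last first.
  by rewrite /d vw !mulr0.
rewrite (sum_words_delta sz1) => [|v _ /negPf vw]; last by rewrite /d vw mulr0.
rewrite /d !eqxx !mulr1 mulrN addrC => /eqP; rewrite subr_eq0 => /eqP ->.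
by rewrite mulrC.
Qed.

Variable xi : A.
Hypothesis xiE : xi = Ph ws.

(** Let v = w <| h - c w.  Both v and its image under the adjoint h' are
    relations, hence orthogonal to w, so that the squared norm of v is 0. *)
Lemma lift_eigen h h' c :
  (forall n f g, ip n (act h f) g = ip n f (act h' g)) ->
  ract P xi h = c *: xi -> forall p, (p < size Js)%N ->
  eqw (size (J p)) (act h (ws p)) (fun s => c * ws p s).
Proof.
move=> adj xic.
have Phact k vs : Ph (fun p => act k (vs p)) = ract P (Ph vs) k.
  by rewrite /Ph ract_sum; apply: eq_bigr => p _; rewrite ract_phi.
pose v p s := - c * ws p s + act h (ws p) s.
have v0 : Ph v = 0.
  rewrite /Ph (eq_bigr (fun p => - c *: phi (J p) (ws p) + phi (J p) (act h (ws p)))).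
    rewrite big_split /= -scaler_sumr -!/(Ph _) (Phact h ws) -xiE xic.
    by rewrite scaleNr addNr.
  by move=> p _; rewrite phi_lin.
have hv0 : Ph (fun p => act h' (v p)) = 0 by rewrite Phact v0 ract0.
have ipD n f g w : ip n (fun s => - c * f s + g s) w = - c * ip n f w + ip n g w.
  rewrite /ip mulr_sumr -big_split /=; apply: eq_bigr => s _.
  by rewrite mulrDl mulrA.
have : \sum_(p <- iota 0 (size Js)) ip (size (J p)) (v p) (v p) = 0.
  under eq_bigr do rewrite ipD adj.
  by rewrite big_split /= -mulr_sumr !ortho // mulr0 addr0.
move/eqP; rewrite psumr_eq0 => [/allP h0 p pJ s hs|p _]; last exact: ip_ge0.
have /ip_eq0 /(_ s hs) : ip (size (J p)) (v p) (v p) = 0.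
  by apply/eqP; apply: h0; rewrite mem_iota.
by move/eqP; rewrite /v mulNr addrC subr_eq0 => /eqP.
Qed.

Lemma lift_low n p : (0 < l)%N -> lowest_elt n xi -> (p < size Js)%N ->
  lowest (size (J p)) (ws p) /\ has_wt n (size (J p)) (ws p).
Proof.
move=> l0 [lF lK lP] pJ; split.
  move=> r s hs; rewrite (lift_eigen (c := 0) (fun n => @ip_adjF n r) _ pJ) ?mul0r //.
  by rewrite lF scale0r.
move=> s hs ws0.
apply/(kprod_last n l0) => [r rl|].
  have := lift_eigen (c := 1) (fun n => @ip_adjK n r) _ pJ hs.
  rewrite scale1r lK // => /(_ erefl); rewrite actK => /(mulIf ws0).
  by rewrite -[1]/(t ^ 0) => /tX_inj.
have adj m f g : ip m (act Kprod f) g = ip m f (act Kprod g).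
  apply: eq_words => v _; rewrite !actKprod rmorphM /= (conj_gt0 (kprod_gt0 _)); ring.
by have := lift_eigen adj lP pJ hs; rewrite actKprod => /(mulIf ws0).
Qed.

End Lift.

Lemma lift_exists (Js : seq word) (cs : nat -> word -> C) :
  exists ws : nat -> word -> C,
  \sum_(p <- iota 0 (size Js)) phi (nth [::] Js p) (cs p) =
  \sum_(p <- iota 0 (size Js)) phi (nth [::] Js p) (ws p) /\
  forall vs : nat -> word -> C,
    \sum_(p <- iota 0 (size Js)) phi (nth [::] Js p) (vs p) = 0 ->
    \sum_(p <- iota 0 (size Js)) ip (size (nth [::] Js p)) (ws p) (vs p) = 0.
Proof.
pose L := [seq (p, s) | p <- iota 0 (size Js), s <- words (size (nth [::] Js p))].
have uL : uniq L.
  apply: allpairs_uniq_dep => //; first exact: iota_uniq.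
    by move=> p _; exact: words_uniq.
  by move=> [p s] [p' s'] _ _ [-> ->].
have [c' [h1 h2]] := @ortho_lift C A _ L (fun x => mon x.2 (nth [::] Js x.1))
   (fun x => cs x.1 x.2) uL.
exists (fun p s => c' (p, s)); split.
  by move: h1; rewrite !big_allpairs_dep /= => ->.
move=> vs hv; have := h2 (fun x => vs x.1 x.2).
by rewrite !big_allpairs_dep /=; apply.
Qed.

(** * Counting the holomorphic sections *)

Definition zblocks (d : letter -> nat) : seq (nat * letter) :=
  [seq (d j, j) | j <- enum 'I_l.+1].

Lemma zword_blocks d : zword d = blocks (zblocks d).
Proof. by rewrite /zword /blocks /zblocks -map_comp. Qed.

Lemma size_zblocks d : size (zblocks d) = l.+1.
Proof. by rewrite size_map size_enum_ord. Qed.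

Lemma size_zword d : size (zword d) = (\sum_j d j)%N.
Proof. by rewrite -sum_count; apply: eq_bigr => j _; rewrite count_zword. Qed.

Lemma has_wt_supp n m w s : has_wt n m w -> size s = m -> w s != 0 ->
  supp m (fun i => count_mem i s) w.
Proof.
by move=> hw hs ws v hv wv; apply: wt_size_inj => [|r]; rewrite ?hv ?hs // !(hw, fun e => hw _ e).
Qed.

Lemma last_root (l0 : (0 < l)%N) : exists2 r : 'I_l, r.+1 = l & hi r = ord_max.
Proof.
have l1 : (l.-1 < l)%N by rewrite prednK.
exists (Ordinal l1); first by rewrite /= prednK.
by apply: val_inj; rewrite /= /bump /= add1n prednK.
Qed.

(** The strip condition of [block_step] makes the weight dominant. *)
Lemma low_neg (n : int) d w : (0 < l)%N -> n < 0 ->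
  qsym (zword d) w -> lowest (size (zword d)) w -> has_wt n (size (zword d)) w ->
  forall s, size s = size (zword d) -> w s = 0.
Proof.
move=> l0 n0 sy lw hw s hs; apply/eqP; apply: contraTT n0 => ws.
have sp := has_wt_supp hw hs ws; have [r rl _] := last_root l0.
have := hw s hs ws r; rewrite /fund_wt rl eqxx -leNgt => <-.
have nz : nonzero (size (zword d)) w by exists s.
move: sy lw sp nz; rewrite zword_blocks /zblocks.
case e : (enum 'I_l.+1) => [|j js].
  by have := size_enum_ord l.+1; rewrite e.
rewrite /blocks /= size_cat size_nseq => sy lw sp nz.
have [B [_ _ _ _ [_ /(_ r) h]]] := block_step sy lw sp nz.
by rewrite /wt subr_ge0 lez_nat (leq_trans _ h) // leq_addl.
Qed.

(** The last row of the weight exceeds the other ones, all equal to some k, by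
    N; then [lowest_lead] applies. *)
Lemma low_pos (N : nat) d w : (0 < l)%N ->
  qsym (zword d) w -> lowest (size (zword d)) w -> has_wt N%:Z (size (zword d)) w ->
  nonzero (size (zword d)) w ->
  exists k : nat, [/\ forall j, (k <= d j)%N, w (lead k (zblocks d)) != 0 &
    (k * l.+1 + N)%N = size (zword d)].
Proof.
move=> l0 sy lw hw [s hs ws].
have sp := has_wt_supp hw hs ws; have [r rl rm] := last_root l0.
have W := hw s hs ws.
pose k := count_mem (ord0 : letter) s.
have eqk (i : letter) : (i < l)%N -> count_mem i s = k.
  case: i => i; elim: i => [|i IH] hi1 il.
    by rewrite /k; congr (count_mem _ _); apply: val_inj.
  have il' : (i < l)%N by apply: ltnW.
  have := W (Ordinal il'); rewrite /fund_wt /= (ltn_eqF il) /wt => /eqP.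
  rewrite subr_eq0 eqz_nat => /eqP.
  have -> : hi (Ordinal il') = Ordinal hi1 by apply: val_inj.
  by move=> ->; rewrite -(IH (ltnW hi1) il'); congr (count_mem _ _); apply: val_inj.
have eqm : count_mem ord_max s = (k + N)%N.
  have := W r; rewrite /fund_wt rl eqxx /wt rm (eqk (lo r) (ltn_ord r)) => /eqP.
  by rewrite subr_eq -PoszD eqz_nat addnC => /eqP.
have sz : (k * l.+1 + N)%N = size s.
  rewrite -sum_count (bigD1 ord_max) //= eqm.
  rewrite (eq_bigr (fun _ => k)) => [|i im]; last first.
    apply: eqk; rewrite ltn_neqAle -ltnS ltn_ord andbT.
    by apply: contra im => /eqP e; apply/eqP/val_inj.
  rewrite sum_nat_const (_ : #|_| = l) ?mulnSr; last first.
    by have := cardC1 (ord_max : letter); rewrite card_ord.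
  by rewrite mulnC -addnA addnC.
exists k.
move: sy lw sp; rewrite zword_blocks => sy lw sp.
have [||||al nl] := andP (@lowest_lead k (zblocks d) w _ _ sy lw sp _ _ _).
- by rewrite size_zblocks.
- by exists s => //; rewrite hs zword_blocks.
- by move=> i il; rewrite size_zblocks ifF ?eqk //; lia.
- by move=> _; rewrite eqm leq_addr.
split=> //; last by rewrite sz hs zword_blocks.
move=> j; have := allP al (d j, j); apply.
by apply: map_f; rewrite mem_enum.
Qed.

Lemma ract_mon s v h : size s = size v ->
  ract P (mon s v) h = \sum_(w <- words (size s)) P h (mon s w) *: mon w v.
Proof. by move=> sv; rewrite /Defs.ract (comul_mon_bilin sv (is_bilin_act P h)). Qed.

Lemma ractF_zw r s : ract P (zw s) (F r) = 0.
Proof.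
have ml : (ord_max == lo r) = false.
  by apply/negP => /eqP /(congr1 val) /= e; have := ltn_ord r; rewrite -e ltnn.
rewrite ract_mon ?size_nseq // big_seq big1 // => w; rewrite mem_words => /eqP hw.
suff -> : P (F r) (mon (nseq (size s) ord_max) w) = 0 by rewrite scale0r.
elim: (size s) w hw => [|n IH] [|j w] // => [_|[hw]]; first exact: PF_nil.
by rewrite -[nseq _ _]/(_ :: nseq n _) PF_cons ?size_nseq // ml IH // mulr0 mul0r addr0.
Qed.

Lemma ractE_zw (r : 'I_l) s : (r.+1 < l)%N -> ract P (zw s) (E r) = 0.
Proof.
move=> rl; have ml : (ord_max == hi r) = false.
  by apply/negP => /eqP /(congr1 val) /=; rewrite /bump /=; lia.
rewrite ract_mon ?size_nseq // big_seq big1 // => w; rewrite mem_words => /eqP hw.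
suff -> : P (E r) (mon (nseq (size s) ord_max) w) = 0 by rewrite scale0r.
elim: (size s) w hw => [|n IH] [|j w] // => [_|[hw]]; first exact: PE_nil.
by rewrite -[nseq _ _]/(_ :: nseq n _) PE_cons ?size_nseq // ml IH // mulr0 mul0r addr0.
Qed.

Lemma ract_diag_zw h (kap : word -> C) s :
  (forall f v, act h f v = kap v * f v) ->
  ract P (zw s) h = kap (nseq (size s) ord_max) *: zw s.
Proof.
move=> hk; have [f hf] := @colspan_mon (nseq (size s) ord_max) s (size_nseq _ _).
pose d (v : word) : C := (v == nseq (size s) ord_max)%:R.
have e : zw s = phi s d.
  rewrite /phi (sum_words_delta (s := nseq (size s) ord_max)) ?size_nseq //.
    by rewrite /d eqxx scale1r.
  by move=> v _ /negPf; rewrite /d => ->; rewrite scale0r.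
rewrite e ract_phi {2}/phi scaler_sumr; apply: eq_bigr => v _.
rewrite hk scalerA /d; case: eqP => [->//|_]; by rewrite !mulr0.
Qed.

Lemma wt_nseq_max r n : wt r (nseq n ord_max) = (hi r == ord_max)%:Z * n%:Z.
Proof.
rewrite /wt !count_nseq /=.
have -> : (ord_max == lo r) = false.
  by apply/negP => /eqP /(congr1 val) /= e; have := ltn_ord r; rewrite -e ltnn.
by rewrite [hi r == _]eq_sym mul0n subr0 PoszM.
Qed.

Lemma lowest_zw s : (0 < l)%N -> lowest_elt (size s)%:Z (zw s).
Proof.
move=> l0.
have W (r : 'I_l) : wt r (nseq (size s) ord_max) = fund_wt (size s)%:Z r.
  rewrite wt_nseq_max /fund_wt.
  have -> : (hi r == ord_max) = (r.+1 == l) by rewrite -val_eqE /= /bump.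
  by case: eqP => _; rewrite ?mul1r ?mul0r.
split; first by move=> r; exact: ractF_zw.
  move=> r rl; rewrite (ract_diag_zw s (fun f v => @actK r f v)) W /fund_wt.
  by rewrite ltn_eqF // expr0z scale1r.
rewrite (ract_diag_zw s actKprod); congr (_ *: _).
apply/(kprod_last _ l0) => [r rl|//].
by rewrite W /fund_wt ltn_eqF.
Qed.

(** The quantum determinant relation lets k be added to all column
    multiplicities at once. *)
Lemma colspan_det s k : colspan (s ++ flatten (nseq k (enum 'I_l.+1))) (zw s).
Proof.
have c1 : colspan (enum 'I_l.+1) 1.
  rewrite -(SUq_det hsu).
  have e (p : 'S_l.+1) : \prod_(i < l.+1) u i (p i) =
      mon (enum 'I_l.+1) (map p (enum 'I_l.+1)).
    transitivity (\prod_(i <- enum 'I_l.+1) u i (p i)).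
      by rewrite enumT [index_enum _]unlock.
    by elim: (enum _) => [|i L IH]; rewrite ?big_nil // big_cons /= IH.
  elim/big_ind: _ => [|a b|p _]; [exact: colspan0 | exact: colspanD |].
  apply: colspanZ; rewrite e; apply: (@colspan_perm (map p (enum 'I_l.+1))).
    apply: uniq_perm; rewrite ?(map_inj_uniq (@perm_inj _ p)) ?enum_uniq // => i.
    rewrite mem_enum; apply/mapP; exists ((p^-1)%g i); rewrite ?mem_enum //.
    by rewrite permKV.
  by apply: colspan_mon; rewrite [RHS]size_map.
have ck : colspan (flatten (nseq k (enum 'I_l.+1))) 1.
  elim: k => [|k IH] /=; first by have := @colspan_mon [::] [::] erefl.
  by rewrite -[1]mulr1; apply: colspanM.
rewrite -[zw s]mulr1; apply: colspanM => //; apply: colspan_mon.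
exact: size_nseq.
Qed.

Lemma lowest_lin m c f g : lowest m f -> lowest m g ->
  lowest m (fun s => c * f s + g s).
Proof. by move=> hf hg r s hs; rewrite act_lin hf // hg // mulr0 addr0. Qed.

Lemma qsym_lin J c f g : qsym J f -> qsym J g -> qsym J (fun s => c * f s + g s).
Proof.
move=> hf hg s1 s2 i j J1 x J2 eJ h1 h2 ij.
by rewrite (hf _ _ _ _ _ _ _ eJ h1 h2 ij) (hg _ _ _ _ _ _ _ eJ h1 h2 ij); ring.
Qed.

Lemma has_wt_lin n m c f g : has_wt n m f -> has_wt n m g ->
  has_wt n m (fun s => c * f s + g s).
Proof.
move=> hf hg s hs; have [f0|fn] := eqVneq (f s) 0; last by move=> _; apply: hf.
by rewrite f0 mulr0 add0r; apply: hg.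
Qed.

(** The space of lifts with column content d is at most a line, because
    [lowest_lead] makes evaluation at the leading word injective on it.  As det is
    1, the monomial with exponents d_j - k also lifts there, so it spans the
    image. *)
Lemma low_line (N : nat) d w : (0 < l)%N ->
  qsym (zword d) w -> lowest (size (zword d)) w -> has_wt N%:Z (size (zword d)) w ->
  exists (c : C) (e : letter -> nat), (\sum_j e j = N)%N /\
    phi (zword d) w = c *: zw (zword e).
Proof.
move=> l0 sy lw hw.
have [r0 _ _] := last_root l0.
have [z0|/existsNP [s /not_implyP [hs /eqP ws]]] :=
    pselect (forall s, size s = size (zword d) -> w s = 0).
  exists 0, (fun j => if j == ord0 then N else 0%N); split.
    by rewrite -big_mkcond big_pred1_eq.
  rewrite scale0r /phi big_seq big1 // => s; rewrite mem_words => /eqP hs.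
  by rewrite z0 // scale0r.
have nz : nonzero (size (zword d)) w by exists s.
have [k [kd lead_w hk]] := low_pos l0 sy lw hw nz.
pose e j := (d j - k)%N.
have de j : d j = (e j + k)%N by rewrite /e subnK.
have eN : (\sum_j e j = N)%N.
  move: hk; rewrite size_zword (eq_bigr _ (fun j _ => de j)) big_split /=.
  by rewrite sum_nat_const card_ord; lia.
pose z0 := zw (zword e).
have [g hg] : colspan (zword d) z0.
  apply: (colspan_perm _ (colspan_det (zword e) k)).
  apply: count_perm => i; rewrite count_cat !count_zword de; congr (_ + _)%N.
  rewrite count_flatten map_nseq sumn_nseq.
  by rewrite (count_uniq_mem _ (enum_uniq _)) mem_enum mul1n.
have lz : lowest_elt N%:Z z0.
  by have := lowest_zw (zword e) l0; rewrite size_zword eN.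
have [ws0 [h1 h2]] := lift_exists [:: zword d] (fun _ => g).
rewrite /= !big_seq1 /= in h1.
have zE : z0 = \sum_(p <- iota 0 (size [:: zword d])) phi (nth [::] [:: zword d] p) (ws0 p).
  by rewrite big_seq1 /= hg h1.
have [lw0 hw0] := lift_low h2 zE l0 lz (isT : (0 < size [:: zword d])%N).
have sy0 := lift_qsym h2 (isT : (0 < size [:: zword d])%N).
rewrite /= in lw0 hw0 sy0; set w0 := ws0 0%N in lw0 hw0 sy0.
have z0E : z0 = phi (zword d) w0 by rewrite hg h1.
have nz0 : nonzero (size (zword d)) w0.
  apply: contrapT => nn; case/eqP: (zw_neq0 (zword e)); rewrite -/z0 z0E.
  rewrite /phi big_seq big1 // => v; rewrite mem_words => /eqP hv.
  have [->|wv] := eqVneq (w0 v) 0; first by rewrite scale0r.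
  by case: nn; exists v.
have [k0 [_ lead_w0 hk0]] := low_pos l0 sy0 lw0 hw0 nz0.
have ek : k0 = k by apply/eqP; rewrite -(eqn_pmul2r (ltn0Sn l)) -(eqn_add2r N) hk0 hk.
rewrite ek in lead_w0; set s0 := lead k (zblocks d) in lead_w lead_w0.
(* Both w and the lift w0 of the monomial are nonzero at the leading word; the
   combination vanishing there vanishes everywhere. *)
pose v s := - (w s0 / w0 s0) * w0 s + w s.
have v0 : forall s, size s = size (zword d) -> v s = 0.
  apply: contrapT => /existsNP [x /not_implyP [hx /eqP vx]].
  have [k1 [_ + hk1]] := low_pos l0 (qsym_lin _ sy0 sy) (lowest_lin _ lw0 lw)
     (has_wt_lin hw0 hw) (ex_intro2 _ _ x hx vx).
  have -> : k1 = k by apply/eqP; rewrite -(eqn_pmul2r (ltn0Sn l)) -(eqn_add2r N) hk1 hk.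
  by rewrite mulNr divfK // addNr eqxx.
exists (w s0 / w0 s0), e; split=> //.
have : phi (zword d) v = 0.
  rewrite /phi big_seq big1 // => x; rewrite mem_words => /eqP hx.
  by rewrite v0 // scale0r.
rewrite phi_lin -z0E scaleNr addrC => /eqP; rewrite subr_eq0 => /eqP ->.
by [].
Qed.

(** Sort the columns of each monomial. *)
Lemma column_decomposition a : exists (Js : seq (letter -> nat)) (cs : nat -> word -> C),
  a = \sum_(p <- iota 0 (size (map zword Js)))
        phi (nth [::] (map zword Js) p) (cs p).
Proof.
have [L ->] := all_spanned a.
have H (x : word * (word -> C)) :
    exists g, phi x.1 x.2 = phi (zword (fun j => count_mem j x.1)) g.
  apply: (@colspan_perm x.1); last by exists x.2.
  by apply: count_perm => i; rewrite count_zword.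
pose g x := projT1 (cid (H x)).
exists [seq (fun j => count_mem j x.1) | x <- L].
exists (fun p => g (nth ([::], fun _ => 0) L p)).
rewrite !size_map (big_nth ([::], fun _ => 0)) /index_iota subn0.
rewrite big_seq [RHS]big_seq; apply: eq_bigr => p; rewrite mem_iota add0n => pL.
rewrite -map_comp (nth_map ([::], fun _ => 0)) //= /g.
by case: cid.
Qed.

Lemma lowest_elt_zw (N : nat) a : (0 < l)%N -> lowest_elt N%:Z a ->
  exists L : seq (C * (letter -> nat)),
    (forall x, List.In x L -> (\sum_j x.2 j = N)%N) /\
    a = \sum_(x <- L) x.1 *: zw (zword x.2).
Proof.
move=> l0 la; have [Js [cs ea]] := column_decomposition a.
have [ws [h1 h2]] := lift_exists (map zword Js) cs.
rewrite h1 in ea; rewrite ea.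
have : forall p, p \in iota 0 (size (map zword Js)) -> exists x : C * (letter -> nat),
    (\sum_j x.2 j = N)%N /\
    phi (nth [::] (map zword Js) p) (ws p) = x.1 *: zw (zword x.2).
  move=> p; rewrite mem_iota add0n => /= pJ.
  have [lw hw] := lift_low h2 ea l0 la pJ.
  have sy := lift_qsym h2 pJ.
  rewrite size_map in pJ.
  rewrite (nth_map (fun _ => 0%N)) // in sy lw hw *.
  by have [c [e [eN h]]] := low_line l0 sy lw hw; exists (c, e).
elim: (iota _ _) => [|p L IH] h.
  by exists [::]; split=> //; rewrite !big_nil.
have [x [xN hx]] := h p (mem_head _ _).
have [|M [MN hM]] := IH; first by move=> p' pL; apply: h; rewrite inE pL orbT.
exists (x :: M); rewrite !big_cons hx hM; split=> // y [<- //|]; exact: MN.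
Qed.

Lemma lowest_elt_neg (n : int) a : (0 < l)%N -> n < 0 -> lowest_elt n a -> a = 0.
Proof.
move=> l0 n0 la; have [Js [cs ea]] := column_decomposition a.
have [ws [h1 h2]] := lift_exists (map zword Js) cs.
rewrite h1 in ea; rewrite ea big_seq big1 // => p; rewrite mem_iota add0n => /= pJ.
have [lw hw] := lift_low h2 ea l0 la pJ.
have sy := lift_qsym h2 pJ.
rewrite size_map in pJ.
rewrite (nth_map (fun _ => 0%N)) // in sy lw hw *.
rewrite /phi big_seq big1 // => s; rewrite mem_words => /eqP hs.
by rewrite (low_neg l0 n0 sy lw hw hs) scale0r.
Qed.

Lemma H0_lowest (n : int) a : (0 < l)%N -> H0 q K E F u P n a <->
  lowest_elt n a /\ forall r : 'I_l, (r.+1 < l)%N -> ract P a (E r) = 0.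
Proof.
move=> l0; split.
  move=> [[hKEF hP'] hn].
  have hF : forall r : 'I_l, (r.+1 < l)%N -> ract P a (F r) = 0.
    by move=> r rl; have [] := hKEF r rl.
  split; last by move=> r rl; have [] := hKEF r rl.
  split; first exact/(nabla_eq0 n l0 hF).
    by move=> r rl; have [] := hKEF r rl.
  by rewrite -fmorphXz; exact: hP'.
move=> [[hF hK hP'] hE]; split; last by apply/nabla_eq0.
split; first by move=> r rl; split; [exact: hK | exact: hE | exact: hF].
by rewrite fmorphXz; exact: hP'.
Qed.

Lemma H0_lin (n : int) c a b : (0 < l)%N -> H0 q K E F u P n a ->
  H0 q K E F u P n b -> H0 q K E F u P n (c *: a + b).
Proof.
move=> l0 /H0_lowest [//|[aF aK aP] aE] /H0_lowest [//|[bF bK bP] bE].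
apply/H0_lowest => //; split; [split|].
- by move=> r; rewrite ract_lin aF bF scaler0 addr0.
- by move=> r rl; rewrite ract_lin aK ?bK.
- by rewrite ract_lin aP bP scalerDr !scalerA mulrC.
- by move=> r rl; rewrite ract_lin aE ?bE // scaler0 addr0.
Qed.

Lemma H0_zw s : (0 < l)%N -> H0 q K E F u P (size s)%:Z (zw s).
Proof.
move=> l0; apply/H0_lowest => //; split; first exact: lowest_zw.
by move=> r rl; apply: ractE_zw.
Qed.

Lemma H0_neg (N : nat) : (0 < l)%N -> (0 < N)%N ->
  H0 q K E F u P (- N%:Z) = [set 0].
Proof.
move=> l0 N0; apply/seteqP; split=> a.
  move=> /H0_lowest [//|la _]; apply: (lowest_elt_neg l0 _ la).
  by rewrite oppr_lt0.
move=> ->; apply/H0_lowest => //; split; [split|]; move=> *; rewrite ract0 //.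
by rewrite scaler0.
Qed.

Lemma H0_pos (N : nat) : (0 < l)%N ->
  subspace_iso (H0 q K E F u P N%:Z) 'C(N + l, l).
Proof.
move=> l0.
pose S := enum [set x : l.+1.-tuple 'I_N.+1 | (\sum_(i <- x) i == N)%N]%SET.
pose J (x : l.+1.-tuple 'I_N.+1) : letter -> nat := fun j => tnth x j.
have sumJ (x : l.+1.-tuple 'I_N.+1) : (\sum_(i <- x) i = \sum_j J x j)%N.
  by rewrite big_tuple.
have memS x : (x \in S) = (\sum_j J x j == N)%N by rewrite mem_enum inE sumJ.
have sS : size S = 'C(N + l, l) by rewrite -cardE card_ord_partitions addnC.
pose x0 : l.+1.-tuple 'I_N.+1 := [tuple ord0 | _ < l.+1].
pose b (i : 'I_('C(N + l, l))) := zw (zword (J (nth x0 S i))).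
pose f (v : 'rV[C]_('C(N + l, l))) : A := \sum_i v 0 i *: b i.
have flin : linear f.
  move=> c v w; rewrite /f scaler_sumr -big_split /=; apply: eq_bigr => i _.
  by rewrite !mxE scalerDl scalerA.
pose fL := GRing.isLinear.Build C 'rV[C]_('C(N + l, l)) A *:%R f flin.
pose g : {linear 'rV[C]_('C(N + l, l)) -> A} := HB.pack f fL.
have bH i : H0 q K E F u P N%:Z (b i).
  have := H0_zw (zword (J (nth x0 S i))) l0; rewrite size_zword.
  have : nth x0 S i \in S by rewrite mem_nth // sS.
  by rewrite memS => /eqP ->.
have H00 : H0 q K E F u P N%:Z 0.
  apply/H0_lowest => //; split; [split|]; move=> *; rewrite ract0 //.
  by rewrite scaler0.
exists g; split.
  have fz v : f v = 0 -> v = 0.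
    move=> fv; apply/rowP => i; rewrite mxE.
    have hf : \sum_(j <- enum 'I_('C(N + l, l))) v 0 j *: b j = 0.
      by rewrite big_enum.
    have := @zw_free _ (enum 'I_('C(N + l, l))) (fun i => zword (J (nth x0 S i))) N
      (fun i => v 0 i) (enum_uniq _).
    apply; last by rewrite mem_enum.
    - move=> j _; rewrite size_zword; apply/eqP; rewrite -memS.
      by rewrite mem_nth // sS.
    - move=> j k _ _ h; apply: val_inj; apply/eqP.
      have uS : uniq S by exact: enum_uniq.
      have szS (i' : 'I_('C(N + l, l))) : (i' < size S)%N by rewrite sS.
      rewrite -(nth_uniq x0 (szS j) (szS k) uS); apply/eqP.
      apply: eq_from_tnth => m; apply: val_inj.
      by have := h m; rewrite !count_zword.
    - exact: hf.
  move=> v w fvw; apply/eqP; rewrite -subr_eq0; apply/eqP; apply: fz.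
  by apply/eqP; rewrite -[f _]/(g _) linearB subr_eq0; apply/eqP.
apply/seteqP; split=> a.
  move=> [v _ <-] /=; rewrite /f.
  elim: (index_enum _) => [|i L IH]; first by rewrite big_nil.
  by rewrite big_cons; apply: H0_lin.
move=> /H0_lowest [//|la _]; have [L [LN ->]] := lowest_elt_zw l0 la.
elim: L LN => [|x L IH] LN.
  by exists 0; rewrite // big_nil [LHS]linear0.
have [|v _ hv] := IH; first by move=> y yL; apply: LN; right.
have xN : (\sum_j x.2 j = N)%N by apply: LN; left.
(* Exponents of total N are at most N, so inord does not truncate them. *)
pose y : l.+1.-tuple 'I_N.+1 := [tuple inord (x.2 j) | j < l.+1].
have yE j : J y j = x.2 j.
  rewrite /J tnth_mktuple inordK // ltnS -xN (bigD1 j) //=; exact: leq_addr.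
have yS : y \in S.
  by rewrite memS; apply/eqP; rewrite -xN; apply: eq_bigr => j _; rewrite yE.
have iy : (index y S < 'C(N + l, l))%N by rewrite -sS index_mem.
exists (x.1 *: delta_mx 0 (Ordinal iy) + v) => //.
rewrite linearP hv big_cons; congr (_ *: _ + _).
rewrite /= /f (bigD1 (Ordinal iy)) //= big1 => [|j ji]; last first.
  by rewrite mxE eqxx /= (negPf ji) scale0r.
rewrite addr0 mxE !eqxx scale1r /b /= nth_index //; congr (zw _).
by rewrite /zword; congr flatten; apply: eq_map => j; rewrite yE.
Qed.

End QuantumProjectiveSpace.

Theorem corollary4p2 (R : realType) (q : R) (hq0 : 0 < q) (hq1 : q < 1)
  (l : nat) (hl : (1 <= l)%N)
  (U : hopfStarAlgType R[i]) (K K' E F : 'I_l -> U)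
  (hU : is_Uq_su q K K' E F)
  (A : hopfStarAlgType R[i]) (u : 'I_l.+1 -> 'I_l.+1 -> A)
  (hA : is_A_SUq q u)
  (P : {bilinear U -> A -> R[i] | *%R & *%R})
  (hP : is_canonical_pairing q K E F u P)
  (N : nat) (hN : (0 < N)%N) :
  subspace_iso (H0 q K E F u P N%:Z) 'C(N + l, l) /\
  H0 q K E F u P (- N%:Z) = [set 0].
Proof.
split; first exact: (H0_pos hq0 hq1 hU hA hP N hl).
exact: (H0_neg hq0 hq1 hU hA hP hl hN).
Qed.
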